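(* For $L>0$ let $X_L$ be the unique surface in the moduli space $\mathcal{M}_{0,3}(L,L,L)$, and let $\delta_{X_L}$ be its critical exponent. Then $$\delta_{X_L}=\frac{\ln(4)}{L}+O_\epsilon\left(e^{-(1-\epsilon)L/4}\right)$$ as $L\to\infty$; that is, for every $\epsilon>0$ there exist $K,L_0>0$ depending only on $\epsilon$ such that $\left|\delta_{X_L}-\frac{\ln 4}{L}\right|\le Ke^{-(1-\epsilon)L/4}$ for all $L\ge L_0$.
   Context: $\mathcal{M}_{0,3}(L,L,L)$ is the moduli space of complete hyperbolic surfaces of genus $0$ with three infinite-area funnels (and no cusps), each of width $L$, the width of a funnel being the length of the closed geodesic separating the funnel from the rest of the surface; it consists of a single surface $X_L$, obtained by gluing funnels to the hyperbolic pair of pants with all three boundary geodesics of length $L$. The critical exponent $\delta_X$ of such a surface $X$ is the exponent of convergence of the Poincaré series of its uniformizing Fuchsian group; equivalently, the rightmost (real) zero of its Selberg zeta function $Z_X(s)=\prod_{\gamma}\prod_{k\ge0}(1-e^{-(s+k)l(\gamma)})$ (analytically continued; product over oriented primitive closed geodesics). *)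

(* Defs.v *)
From HB Require Import structures.
From mathcomp Require Import all_boot all_order all_algebra.
From mathcomp Require Import all_classical all_reals all_analysis.
From mathcomp Require Import complex.

Set Implicit Arguments.
Unset Strict Implicit.
Unset Printing Implicit Defensive.

Import Order.TTheory GRing.Theory Num.Theory.
Import numFieldNormedType.Exports.

Local Open Scope classical_set_scope.
Local Open Scope complex_scope.
Local Open Scope ring_scope.

Definition upper_half_plane (R : realType) : set R[i] :=
  [set z | 0 < complex.Im z].

Definition mobius (R : realType) (g : 'M[R]_2) (z : R[i]) : R[i] :=
  ((g 0 0)%:C * z + (g 0 1)%:C) / ((g 1 0)%:C * z + (g 1 1)%:C).

Definition arcosh (R : realType) (x : R) : R :=
  ln (x + Num.sqrt (x ^+ 2 - 1)).

Definition hdist (R : realType) (z w : R[i]) : R :=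
  arcosh (1 + complex.Re `|z - w| ^+ 2
              / (2 * complex.Im z * complex.Im w)).

Definition SL2_subgroup (R : realType) (G : set 'M[R]_2) : Prop :=
  [/\ G 1,
      forall g, G g -> \det g = 1,
      forall g h, G g -> G h -> G (g * h)
    & forall g, G g -> G g^-1].

Definition SL2_generated_by (R : realType) (n : nat)
    (G : set 'M[R]_2) (c : 'I_n -> 'M[R]_2) : Prop :=
  (forall j, G (c j)) /\
  (forall H : set 'M[R]_2,
     SL2_subgroup H -> (forall j, H (c j)) -> G `<=` H).

Definition discrete_subgroup (R : realType) (G : set 'M[R]_2) : Prop :=
  \forall g \near (1 : 'M[R]_2), G g -> g = 1.

Definition acts_freely (R : realType) (G : set 'M[R]_2) : Prop :=
  forall g z, G g -> upper_half_plane z -> mobius g z = z -> g = 1.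

(* The complete hyperbolic surfaces are the quotients of the upper half-plane
   by discrete subgroups of PSL_2(R) that act freely.  When the surface is not
   compact such a group is a free group, hence lifts isomorphically to
   SL_2(R); we work with lifts.  Since -1 acts trivially, [acts_freely]
   excludes it, so that a group G as below maps injectively to PSL_2(R). *)
Definition surface_group (R : realType) (G : set 'M[R]_2) : Prop :=
  [/\ SL2_subgroup G, discrete_subgroup G & acts_freely G].

(* The funnel of width l is the quotient of the quarter-plane
   {z | Im z > 0, Re z > 0}, a hyperbolic half-plane, by z |-> e^l z.  Its
   boundary geodesic is the image of the imaginary axis and has length l. *)
Definition model_half_plane (R : realType) : set R[i] :=
  [set z | 0 < complex.Im z /\ 0 < complex.Re z].

Definition model_translation (R : realType) (l : R) : 'M[R]_2 :=
  \matrix_(i, j) (if i != j then 0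
                  else if i == 0 then expR (l / 2) else expR (- (l / 2))).

Definition half_plane (R : realType) (h : 'M[R]_2) : set R[i] :=
  mobius h @` @model_half_plane R.

(* The half-planes h_j Q, with Q the model half-plane, project to pairwise
   disjoint embedded funnels in the quotient by G, the j-th one of width l_j
   and with boundary loop the class of c_j.  The sign in the second clause is
   the ambiguity of lifting c_j from PSL_2(R) to SL_2(R). *)
Definition disjoint_funnels (R : realType) (n : nat) (G : set 'M[R]_2)
    (l : 'I_n -> R) (c h : 'I_n -> 'M[R]_2) : Prop :=
  [/\ forall j, \det (h j) = 1,
      forall j, G (c j) /\
        (c j = h j * model_translation (l j) * (h j)^-1 \/
         c j = - (h j * model_translation (l j) * (h j)^-1))
    & forall i j g z, G g -> half_plane (h i) z ->
        half_plane (h j) (mobius g z) ->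
        i = j /\ exists k : int, g = c i ^ k].

(* The complement of the funnels in the quotient is compact: there are no
   other funnels and no cusps.  [R[i]^o] carries the usual topology. *)
Definition compact_outside_funnels (R : realType) (n : nat)
    (G : set 'M[R]_2) (h : 'I_n -> 'M[R]_2) : Prop :=
  exists K : set R[i]^o,
    [/\ compact K, K `<=` @upper_half_plane R
      & forall z, @upper_half_plane R z ->
          exists2 g, G g & K (mobius g z) \/
                           exists j, half_plane (h j) (mobius g z)].

(* G uniformizes a complete hyperbolic surface of genus 0 with exactly n
   funnels, of widths l_1, ..., l_n, and no cusps.  The topological type is
   given by the standard presentation of the fundamental group of the sphere
   with n holes: it is generated by the boundary loops c_1, ..., c_n, which
   have product 1 when they are all oriented alike with respect to their hole
   (here: each funnel lies to the right of its boundary loop).  No further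
   relation has to be excluded: the group of a surface of genus g with n >= 1
   funnels is free of rank 2g + n - 1, while c_1, ..., c_(n-1) generate G, so
   that g = 0. *)
Definition genus0_funnel_group (R : realType) (n : nat) (l : 'I_n -> R)
    (G : set 'M[R]_2) : Prop :=
  surface_group G /\
  exists c h : 'I_n -> 'M[R]_2,
    [/\ disjoint_funnels G l c h,
        compact_outside_funnels G h,
        SL2_generated_by G c
      & \prod_(j < n) c j = 1].

Definition moduli_0_3 (R : realType) (l1 l2 l3 : R) (G : set 'M[R]_2) : Prop :=
  genus0_funnel_group (tnth [tuple l1; l2; l3]) G.

Definition poincare_series (R : realType) (G : set 'M[R]_2) (z w : R[i])
    (s : R) : \bar R :=
  (\esum_(g in G) (expR (- s * hdist z (mobius g w)))%:E)%E.

(* By the triangle inequality, convergence does not depend on the base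
   points, here both equal to i. *)
Definition critical_exponent (R : realType) (G : set 'M[R]_2) : R :=
  let i := 0 +i* 1 in inf [set s : R | (poincare_series G i i s < +oo)%E].

(* Main.v *)
Require Import Defs.
From mathcomp Require Import all_boot all_order all_algebra.
From mathcomp Require Import all_classical all_reals all_analysis.
From mathcomp Require Import complex finmap ring lra.
Import Order.TTheory GRing.Theory Num.Theory.
Local Open Scope ring_scope.

Set Implicit Arguments.
Unset Strict Implicit.
Unset Printing Implicit Defensive.

(** The surface is the double of a right-angled hexagon with alternate sides of
    length [L / 2], so its group consists of the words of even length in the
    reflections in the three other sides.  These sides lie on three geodesics at
    distance [L / 2] of each other, permuted by a rotation of order three.  A
    reduced word chooses between two reflections at each letter, and each letter
    moves a point by [L / 2], up to an exponentially small error; so there are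
    about [2 ^ n] elements of displacement about [n * L / 2], and the exponent
    is about [ln 2 / (L / 2) = ln 4 / L].

    The group is not given as a reflection group, and the first part of the
    proof recovers this structure.  Two boundary loops and their product are
    translations by [L], so each has trace [u = 2 * cosh (L / 2)] up to sign; the
    disjointness of two funnels determines the only sign that matters
    ([pants_boundary_traces]).  A pair of matrices is determined up to
    conjugation by these traces ([pair_conjugate]), hence is conjugate to the
    pair formed by products of reflections ([pants_group_words]).

    The second part replaces hyperbolic distances by matrix norms, through
    [cosh (d (i, g i)) = |g| ^ 2 / 2] ([hdist_i]).  In suitable coordinates each
    letter is a matrix that maps a narrow cone into itself and stretches vectors
    by a factor between two numbers with squares [u - 1] and [u + 2]
    ([step_cone], [step_le]).  Comparing the Poincare series with
    geometric series gives the explicit bounds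
    [ln 2 / ln (u + 2) <= delta <= ln 2 / ln (u - 1)]
    ([critical_exponent_pants_bounds]).  Both logarithms are
    [L / 2 + O(expR (- L / 2))], and hence both bounds are
    [ln 4 / L + O(expR (- L / 2))], which is stronger than the claim. *)

(** * Two by two matrices *)

Section Matrices.
Context {R : realType}.
Implicit Types A B : 'M[R]_2.

Definition mx2 (a b c d : R) : 'M[R]_2 :=
  \matrix_(i, j) if i == 0 then (if j == 0 then a else b)
                 else (if j == 0 then c else d).

Lemma mx2_eta A : A = mx2 (A 0 0) (A 0 1) (A 1 0) (A 1 1).
Proof.
apply/matrixP => i j; rewrite mxE.
by case: i j => [[|[|//]] ?] [[|[|//]] ?] /=; congr (A _ _); apply/val_inj.
Qed.

Lemma mx2_mul a b c d a' b' c' d' :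
  mx2 a b c d * mx2 a' b' c' d' =
  mx2 (a * a' + b * c') (a * b' + b * d') (c * a' + d * c') (c * b' + d * d').
Proof.
apply/matrixP => i j; rewrite !mxE !big_ord_recl big_ord0 addr0 !mxE.
by case: i j => [[|[|//]] ?] [[|[|//]] ?].
Qed.

Lemma mx2_1 : 1 = mx2 1 0 0 1.
Proof. by rewrite [LHS]mx2_eta !mxE. Qed.

Lemma mx2_det a b c d : \det (mx2 a b c d) = a * d - b * c.
Proof.
rewrite (expand_det_row _ 0) !big_ord_recl big_ord0 addr0 !mxE /=.
rewrite /cofactor !det_mx11 !mxE /= expr0 expr1 mul1r.
by rewrite mulrA mulrN1 mulNr.
Qed.

Lemma mx2_tr a b c d : \tr (mx2 a b c d) = a + d.
Proof. by rewrite /mxtrace !big_ord_recl big_ord0 !mxE addr0. Qed.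

Lemma left_inverse_mx2 A B : A * B = 1 -> B * A = 1.
Proof. by move=> h; apply: mulmx1C. Qed.

Lemma invr_mx2 A B : A * B = 1 -> A^-1 = B.
Proof.
move=> h; have uA : A \is a GRing.unit.
  by apply/unitrP; exists B; split => //; apply: left_inverse_mx2.
by rewrite -[LHS]mulr1 -h mulKr.
Qed.

Lemma mx2_inv a b c d : a * d - b * c = 1 ->
  (mx2 a b c d)^-1 = mx2 d (- b) (- c) a.
Proof.
by move=> h; apply: invr_mx2; rewrite mx2_mul mx2_1; congr mx2; nra.
Qed.

(** The square of the Frobenius norm: [cosh (d (i, g i)) = frob2 g / 2] for [g] of
    determinant one, and submultiplicativity lets a conjugation cost only a
    bounded factor. *)
Definition frob2 A : R := A 0 0 ^+ 2 + A 0 1 ^+ 2 + A 1 0 ^+ 2 + A 1 1 ^+ 2.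

Lemma frob2_mx2 a b c d : frob2 (mx2 a b c d) = a ^+ 2 + b ^+ 2 + c ^+ 2 + d ^+ 2.
Proof. by rewrite /frob2 !mxE. Qed.

Lemma frob2_ge0 A : 0 <= frob2 A.
Proof. by rewrite !addr_ge0 ?sqr_ge0. Qed.

Lemma frob2N A : frob2 (- A) = frob2 A.
Proof. by rewrite /frob2 !mxE !sqrrN. Qed.

(** Cauchy-Schwarz, through Lagrange's identity for each entry. *)
Lemma frob2M A B : frob2 (A * B) <= frob2 A * frob2 B.
Proof.
rewrite (mx2_eta A) (mx2_eta B) mx2_mul !frob2_mx2.
move: (A 0 0) (A 0 1) (A 1 0) (A 1 1) (B 0 0) (B 0 1) (B 1 0) (B 1 1).
move=> a b c d a' b' c' d'; rewrite -subr_ge0.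
have -> : (a ^+ 2 + b ^+ 2 + c ^+ 2 + d ^+ 2) *
    (a' ^+ 2 + b' ^+ 2 + c' ^+ 2 + d' ^+ 2) -
    ((a * a' + b * c') ^+ 2 + (a * b' + b * d') ^+ 2 +
     (c * a' + d * c') ^+ 2 + (c * b' + d * d') ^+ 2) =
    (a * c' - b * a') ^+ 2 + (a * d' - b * b') ^+ 2 +
    (c * c' - d * a') ^+ 2 + (c * d' - d * b') ^+ 2 by ring.
by rewrite !addr_ge0 ?sqr_ge0.
Qed.

(** [frob2 A - 2 * \det A] is a sum of two squares. *)
Lemma frob2_ge2 A : \det A = 1 -> 2 <= frob2 A.
Proof.
rewrite (mx2_eta A) mx2_det frob2_mx2.
move: (A 0 0) (A 0 1) (A 1 0) (A 1 1) => a b c d h.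
have := sqr_ge0 (a - d); have := sqr_ge0 (b + c); nra.
Qed.

End Matrices.

(** * The action on the upper half-plane *)

Section Mobius.
Context {R : realType}.
Implicit Types (g h : 'M[R]_2) (z : R[i]).
Local Open Scope complex_scope.

Lemma mobius1 z : mobius (1 : 'M[R]_2) z = z.
Proof. by rewrite /mobius !mxE /= mul1r addr0 mul0r add0r divr1. Qed.

Lemma complex_denom_neq0 (c d : R) z : complex.Im z != 0 ->
  (c != 0) || (d != 0) -> c%:C * z + d%:C != 0.
Proof.
case: z => x y /= y0 cd; rewrite eq_complex /= !mul0r subr0 !addr0.
apply/negP => /andP[/eqP e1]; rewrite mulf_eq0 (negPf y0) orbF => /eqP c0.
by move: cd e1; rewrite c0 eqxx mul0r add0r /= => /eqP.
Qed.

Lemma lower_row_neq0 g : \det g = 1 -> (g 1 0 != 0) || (g 1 1 != 0).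
Proof.
rewrite {1}(mx2_eta g) mx2_det -negb_and; apply: contra_eqN => /andP[/eqP-> /eqP->].
by rewrite !mulr0 subr0 eq_sym oner_neq0.
Qed.

Lemma mobiusM g h z : complex.Im z != 0 -> \det h = 1 ->
  mobius (g * h) z = mobius g (mobius h z).
Proof.
move=> z0 /lower_row_neq0.
have -> : mobius (g * h) z = mobius (mx2 (g 0 0) (g 0 1) (g 1 0) (g 1 1) *
    mx2 (h 0 0) (h 0 1) (h 1 0) (h 1 1)) z by rewrite -!mx2_eta.
rewrite mx2_mul /mobius !mxE /=.
move: (g 0 0) (g 0 1) (g 1 0) (g 1 1) (h 0 0) (h 0 1) (h 1 0) (h 1 1).
move=> a b c d a' b' c' d' dh.
have D : c'%:C * z + d'%:C != 0.
  exact: complex_denom_neq0.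
rewrite !rmorphD !rmorphM /=.
set D' := c'%:C * z + d'%:C in D *.
have e (p q : R[i]) : p * ((a'%:C * z + b'%:C) / D') + q =
   (p * (a'%:C * z + b'%:C) + q * D') / D' by field.
rewrite !e -mulf_div divff ?invr_eq0 // mulr1.
by congr (_ / _); rewrite /D'; ring.
Qed.

Lemma mobiusE g (x y : R) : y != 0 -> \det g = 1 ->
  let D := (g 1 0 * x + g 1 1) ^+ 2 + (g 1 0 * y) ^+ 2 in
  0 < D /\ mobius g (x +i* y) =
   ((((g 0 0 * x + g 0 1) * (g 1 0 * x + g 1 1) + g 0 0 * g 1 0 * y ^+ 2) / D)
     +i* (y / D)).
Proof.
move=> y0 dg D.
have Dg0 : (g 1 0)%:C * (x +i* y) + (g 1 1)%:C != 0.
  by apply: complex_denom_neq0 => //; apply: lower_row_neq0.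
have DE : 0 < D.
  rewrite lt_neqAle addr_ge0 ?sqr_ge0 // andbT eq_sym.
  apply: contra Dg0; rewrite paddr_eq0 ?sqr_ge0 // !sqrf_eq0 => /andP[/eqP e1 /eqP e2].
  by rewrite eq_complex /= !mul0r subr0 !addr0 e1 e2 eqxx.
split=> //; rewrite /mobius.
apply: (mulIf Dg0); rewrite divfK //; apply/eqP.
move: dg; rewrite {1}(mx2_eta g) mx2_det => dg.
rewrite -[y / D]mul1r -dg eq_complex /=; move: DE; rewrite lt0r => /andP[+ _].
by rewrite /D => DN; apply/andP; split; apply/eqP; field.
Qed.

End Mobius.

Section Displacement.
Context {R : realType}.
Local Open Scope complex_scope.

(** [arcosh] is the logarithm up to an additive error in [[0, ln 2]]; this
    changes the terms of a Poincare series by a bounded factor only. *)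
Lemma arcosh_bounds (y : R) : 1 <= y -> ln y <= arcosh y <= ln (2 * y).
Proof.
move=> y1; have y0 : 0 < y by apply: lt_le_trans y1.
have s0 := sqrtr_ge0 (y ^+ 2 - 1).
have s1 : Num.sqrt (y ^+ 2 - 1) <= y.
  by rewrite -[leRHS](ger0_norm (ltW y0)) -sqrtr_sqr ler_wsqrtr // lerBlDr lerDl.
by rewrite /arcosh !ler_ln ?posrE; lra.
Qed.

Lemma hdist_i (g : 'M[R]_2) : \det g = 1 ->
  hdist (0 +i* 1) (mobius g (0 +i* 1)) = arcosh (frob2 g / 2).
Proof.
move=> dg; have [D0 ->] := @mobiusE _ g 0 1 (oner_neq0 _) dg.
rewrite /hdist normc_def /= sqr_sqrtr ?addr_ge0 ?sqr_ge0 //; congr arcosh.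
move: dg D0; rewrite {1}(mx2_eta g) mx2_det /frob2.
move: (g 0 0) (g 0 1) (g 1 0) (g 1 1) => a b c d dg.
rewrite !mulr0 !add0r !mulr1 expr1n mulr1 => D0.
have N0 : d ^+ 2 + c ^+ 2 != 0 by rewrite gt_eqF.
have e : (b * d + a * c) ^+ 2 =
  (a ^+ 2 + b ^+ 2) * (d ^+ 2 + c ^+ 2) - (a * d - b * c) ^+ 2 by ring.
rewrite sqrrN expr_div_n e dg; field.
by rewrite N0.
Qed.

Lemma hdist_i_bounds (g : 'M[R]_2) : \det g = 1 ->
  ln (frob2 g / 2) <= hdist (0 +i* 1) (mobius g (0 +i* 1)) <= ln (frob2 g).
Proof.
move=> dg; have g2 := frob2_ge2 dg; rewrite hdist_i //.
rewrite -[X in _ <= _ <= ln X](_ : 2 * (frob2 g / 2) = _);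
  first by apply: arcosh_bounds; lra.
by field.
Qed.

Lemma hdist_i_ge0 (g : 'M[R]_2) : \det g = 1 ->
  0 <= hdist (0 +i* 1) (mobius g (0 +i* 1)).
Proof.
move=> dg; have /andP[+ _] := hdist_i_bounds dg; apply: le_trans.
by apply: ln_ge0; have := frob2_ge2 dg; lra.
Qed.

End Displacement.

(** * Half-planes bounding the funnels *)

Section Funnels.
Context {R : realType}.
Local Open Scope complex_scope.

(** The entries of [k] satisfy [(a c) (b d) = (b c) (1 + b c)], which is negative
    here: the images [b / d] and [a / c] of the ends of the imaginary axis have
    opposite signs, so that the axis and its image cross. *)
Lemma crossing_half_planes (k : 'M[R]_2) : \det k = 1 ->
  -1 < k 0 1 * k 1 0 < 0 ->
  exists2 z, model_half_plane z & model_half_plane (mobius k z).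
Proof.
move=> dk /andP[k1 k0].
suff [x [y [x0 y0 h]]] : exists x y : R, [/\ 0 < x, 0 < y &
    0 < (k 0 0 * x + k 0 1) * (k 1 0 * x + k 1 1) + k 0 0 * k 1 0 * y ^+ 2].
  exists (x +i* y); first by split.
  have [D0 ->] := @mobiusE _ k x y (lt0r_neq0 y0) dk.
  by split=> /=; apply: divr_gt0.
move: dk k1 k0; rewrite {1}(mx2_eta k) mx2_det.
move: (k 0 0) (k 0 1) (k 1 0) (k 1 1) => a b c d dk k1 k0.
have ac : (a * c) * (b * d) < 0 by nra.
have [p|p|p] := ltgtP (a * c) 0; last by move: ac; rewrite p mul0r ltxx.
- (* [k 0 = b / d] is positive: take a point close to 0 *)
  have r0 : 0 < b * d by rewrite -(nmulr_rlt0 _ p).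
  pose N := 1 + b * d + 2 * `|a * c| + `|a * d + b * c|.
  have N0 : 0 < N
    by rewrite /N; move: (normr_ge0 (a * c)) (normr_ge0 (a * d + b * c)); lra.
  pose x := b * d / N; have x0 : 0 < x by rewrite divr_gt0.
  exists x, x; split => //.
  have xN : x * N = b * d by rewrite divfK // gt_eqF.
  have x1 : x <= 1.
    rewrite ler_pdivrMr // mul1r /N.
    by move: (normr_ge0 (a * c)) (normr_ge0 (a * d + b * c)); lra.
  have -> : (a * x + b) * (c * x + d) + a * c * x ^+ 2 =
    2 * (a * c) * x ^+ 2 + (a * d + b * c) * x + x * N by rewrite xN; ring.
  have q0 : 0 <= x * (`|a * d + b * c| + (a * d + b * c)).
    apply: mulr_ge0; first exact: ltW.
    by move: (ler_norm (- (a * d + b * c))); rewrite normrN; lra.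
  have p0 : 0 <= x * (`|a * c| + a * c * x).
    by apply: mulr_ge0; [exact: ltW | rewrite ltr0_norm //; nra].
  have s0 : 0 < x * (1 + b * d) by rewrite mulr_gt0 // addr_gt0.
  by rewrite /N; nra.
- (* [k oo = a / c] is positive: take a point high enough on the line
     of real part 1 *)
  pose y := (1 + `|a * d + b * c| + `|b * d|) / (a * c) + 1.
  have q0 : 0 < (1 + `|a * d + b * c| + `|b * d|) / (a * c).
    by rewrite divr_gt0 // -addrA ltr_pwDl // addr_ge0 // normr_ge0.
  exists 1, y; split => //; first by rewrite addr_gt0.
  have yE : a * c * y = 1 + `|a * d + b * c| + `|b * d| + a * c.
    by rewrite /y mulrDr mulr1 mulrC divfK // gt_eqF.
  have -> : (a * 1 + b) * (c * 1 + d) + a * c * y ^+ 2 =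
    a * c + (a * d + b * c) + b * d + a * c * y * y by ring.
  have y1 : 1 <= y by rewrite lerDr ltW.
  have s0 : 0 <= (1 + `|a * d + b * c| + `|b * d| + a * c) * (y - 1).
    by rewrite mulr_ge0 ?subr_ge0 // addr_ge0 ?ltW // !addr_ge0.
  rewrite yE; move: (ler_norm (- (b * d))) (ler_norm (- (a * d + b * c))).
  by rewrite !normrN; nra.
Qed.

Lemma half_planes_meet (h k : 'M[R]_2) : \det h = 1 -> \det k = 1 ->
  -1 < k 0 1 * k 1 0 < 0 ->
  exists2 z, half_plane h z & half_plane (h * k) z.
Proof.
move=> dh dk /(crossing_half_planes dk)[z zQ kzQ].
exists (mobius h (mobius k z)); first by exists (mobius k z).
by exists z => //; rewrite mobiusM // gt_eqF //; case: zQ.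
Qed.
End Funnels.

Section BoundaryTraces.
Context {R : realType}.
Implicit Types (A B h k : 'M[R]_2).

Lemma det1_unit h : \det h = 1 -> h \is a GRing.unit.
Proof. by move=> dh; rewrite -[_ \is a _]/(h \in unitmx) unitmxE dh unitr1. Qed.

Lemma det_mulr A B : \det (A * B) = \det A * \det B.
Proof. exact: det_mulmx. Qed.

Lemma mxtrace_conj h A : h \is a GRing.unit -> \tr (h * A * h^-1) = \tr A.
Proof. by move=> uh; rewrite [LHS]mxtrace_mulC -[_ *m _]/(h^-1 * (h * A)) mulKr. Qed.

Lemma det_conj h A : h \is a GRing.unit -> \det (h * A * h^-1) = \det A.
Proof.
by move=> uh; rewrite !det_mulr mulrAC -det_mulr mulrV // det1 mul1r.
Qed.

Lemma model_translationE (l : R) :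
  model_translation l = mx2 (expR (l / 2)) 0 0 (expR (- (l / 2))).
Proof. by rewrite [LHS]mx2_eta !mxE. Qed.

Lemma det_model_translation (l : R) : \det (model_translation l) = 1.
Proof. by rewrite model_translationE mx2_det -expRD subrr expR0 mulr0 subr0. Qed.

Lemma tr_model_translation (l : R) :
  \tr (model_translation l) = expR (l / 2) + expR (- (l / 2)).
Proof. by rewrite model_translationE mx2_tr. Qed.

Lemma tr_inv_mx2 A : \det A = 1 -> \tr A^-1 = \tr A.
Proof.
rewrite (mx2_eta A) mx2_det => dA; rewrite mx2_inv // !mx2_tr; exact: addrC.
Qed.

(** The trace depends on the relative position of the two axes through the
    single number [k 0 1 * k 1 0]; it lies strictly between -1 and 0 exactly
    when the axes cross. *)
Lemma tr_two_translations (l : R) k : \det k = 1 ->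
  let T := model_translation l in let u := expR (l / 2) + expR (- (l / 2)) in
  \tr (T * (k * T * k^-1)) = u ^+ 2 - 2 + k 0 1 * k 1 0 * (u ^+ 2 - 4).
Proof.
rewrite {1}(mx2_eta k) mx2_det => dk T u.
have tt : expR (l / 2) * expR (- (l / 2)) = 1 by rewrite -expRD subrr expR0.
rewrite {1 2}(mx2_eta k) mx2_inv // /T model_translationE !mx2_mul mx2_tr /u.
move: dk tt; move: (expR _) (expR _) (k 0 0) (k 0 1) (k 1 0) (k 1 1).
move=> t t' a b c d dk tt.
transitivity ((a * d - b * c + b * c) * (t ^+ 2 + t' ^+ 2) - 2 * (b * c) * (t' * t)).
  by ring.
have -> : (t' + t) ^+ 2 = t ^+ 2 + t' ^+ 2 + 2 * (t' * t) by ring.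
by rewrite dk tt; ring.
Qed.

(** The relation [c 0 * c 1 * c 2 = 1] forces the product of the two translations
    to have trace [u] or [- u], the sign being lost in the lift from PSL_2.  The
    value [u] would give [k 0 1 * k 1 0 = - (u + 1) / (u + 2)], so that the axes
    would cross, and the half-planes of two different funnels would meet. *)
Lemma pants_boundary_traces (G : set 'M[R]_2) (l : R) (c h : 'I_3 -> 'M[R]_2) :
  let u := expR (l / 2) + expR (- (l / 2)) in
  0 < l -> G 1 -> disjoint_funnels G (tnth [tuple l; l; l]) c h ->
  \prod_(j < 3) c j = 1 ->
  exists A B, [/\ \det A = 1, \det B = 1,
    [/\ \tr A = u, \tr B = u & \tr (A * B) = - u],
    c 0 = A \/ c 0 = - A & c 1 = B \/ c 1 = - B].
Proof.
move=> u l0 G1 [dh cE disj] cprod.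
have lE (j : 'I_3) : tnth [tuple l; l; l] j = l.
  by rewrite (tnth_nth 0); case: j => [[|[|[|//]]] ?].
have u2 : 2 < u.
  rewrite /u expRN; have t1 : 1 < expR (l / 2) by rewrite expR_gt1 divr_gt0.
  have t0 : 0 < expR (l / 2) by exact: expR_gt0.
  rewrite -subr_gt0.
  have -> : expR (l / 2) + (expR (l / 2))^-1 - 2 =
    (expR (l / 2) - 1) ^+ 2 / expR (l / 2) by field; rewrite gt_eqF.
  by rewrite divr_gt0 // exprn_gt0 // subr_gt0.
set T := model_translation l in cE *.
pose C j := h j * T * (h j)^-1.
have cC j : c j = C j \/ c j = - C j by have [_] := cE j; rewrite lE.
have hU j : h j \is a GRing.unit by apply: det1_unit.
have dC j : \det (C j) = 1 by rewrite /C det_conj // det_model_translation.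
have tC j : \tr (C j) = u by rewrite /C mxtrace_conj // tr_model_translation.
exists (C 0), (C 1); split; do ?[exact: dC | exact: cC]; split; do ?exact: tC.
have CU j : C j \is a GRing.unit by apply: det1_unit.
have trC : \tr (C 0 * C 1) = u \/ \tr (C 0 * C 1) = - u.
  pose i2 : 'I_3 := lift ord0 (lift ord0 ord0).
  have cprod3 : c 0 * c 1 * c i2 = 1.
    rewrite -cprod !big_ord_recl big_ord0 mulr1 mulrA.
    by congr (c _ * c _ * c _); apply/val_inj.
  have : C 0 * C 1 * C i2 = 1 \/ C 0 * C 1 * C i2 = - 1.
    move: cprod3.
    by case: (cC 0) (cC 1) (cC i2) => -> [] -> [] ->;
      rewrite ?(mulNr, mulrN, opprK) => <-; rewrite ?opprK;
      [left|right|right|left|right|left|left|right].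
  case=> /(canRL (mulrK (CU i2))) ->; [left|right].
    by rewrite mul1r tr_inv_mx2 ?tC.
  by rewrite mulN1r raddfN /= tr_inv_mx2 ?tC.
case: trC => // trC; exfalso.
pose k := (h 0)^-1 * h 1.
have kE : h 1 = h 0 * k by rewrite /k mulVKr.
have dk : \det k = 1 by rewrite /k det_mulr -[(h 0)^-1]/(invmx _) det_inv !dh invr1 mulr1.
have kU := det1_unit dk.
have trk : \tr (T * (k * T * k^-1)) = u.
  rewrite -trC /C kE (invrM (hU 0) kU) -[LHS](mxtrace_conj _ (hU 0)); congr (\tr _).
  by rewrite !mulrA mulrVK.
have k01 : -1 < k 0 1 * k 1 0 < 0.
  move: trk; rewrite tr_two_translations // -/u; move: (k 0 1 * k 1 0) => x trk.
  have x2 : x * (u + 2) = - (u + 1).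
    by apply: (@mulfI _ (u - 2)); [rewrite subr_eq0 gt_eqF | move=> /=; lra].
  have u0 : 0 < u + 2 by lra.
  by rewrite -(ltr_pM2r u0) -(ltr_pM2r u0 x) x2 mul0r; lra.
have [z zQ0 zQ1] := half_planes_meet (dh 0) dk k01.
by have [] := disj 0 1 1 z G1 zQ0 _; rewrite ?mobius1 ?kE.
Qed.

End BoundaryTraces.

(** * Rigidity of pairs with given traces *)

Section NormalForm.
Context {R : realType}.
Implicit Types (A B P : 'M[R]_2).

Lemma proportional (x y x' y' : R) : (x != 0) || (y != 0) -> x * y' = y * x' ->
  exists m, x' = m * x /\ y' = m * y.
Proof.
move=> /orP[z|z] e; [exists (x' / x) | exists (y' / y)].
  by rewrite divfK //; split=> //; apply: (mulfI z); rewrite e; field.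
by rewrite divfK //; split=> //; apply: (mulfI z); rewrite -e; field.
Qed.

Lemma cancel_vector (x y m n : R) : (x != 0) || (y != 0) ->
  m * x = n * x -> m * y = n * y -> m = n.
Proof. by move=> /orP[] z e f; [apply: (mulIf z) | apply: (mulIf z)]. Qed.

Lemma eigenvector_mx2 (a b c d t : R) : 1 < t -> a * d - b * c = 1 ->
  a + d = t + t^-1 ->
  exists x y, [/\ (x != 0) || (y != 0), a * x + b * y = t * x & c * x + d * y = t * y].
Proof.
move=> t1 dt tr; have t0 : t != 0 by rewrite gt_eqF //; lra.
have ch : (t - a) * (t - d) = b * c.
  have -> : d = t + t^-1 - a by rewrite -tr; ring.
  have -> : b * c = a * d - 1 by rewrite -dt; ring.
  have -> : d = t + t^-1 - a by rewrite -tr; ring.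
  by field.
have [z|z] := boolP ((b != 0) || (t - a != 0)).
  by exists b, (t - a); split => //; [ring | move: ch; lra].
exists (t - d), c; split; [|by move: ch; lra|by ring].
move: z; rewrite negb_or !negbK => /andP[/eqP b0 /eqP a0].
rewrite subr_eq0; apply/orP; left; apply/eqP => td.
have : t^-1 < t by rewrite (@lt_trans _ _ 1) // invf_lt1 //; lra.
by move: tr; rewrite -td; lra.
Qed.

(** In the basis [(v, B v)], with [v] an eigenvector of [A] for [t], the matrix of
    [B] is known by Cayley-Hamilton, and that of [A] by the polarized identity
    [A B + B A = tr A B + tr B A + (tr (A B) - tr A tr B)].  The two vectors are
    independent, since on a common eigenvector [tr (A B)] would be positive. *)
Lemma pair_normal_form (t : R) A B : 1 < t ->
  let u := t + t^-1 in
  \det A = 1 -> \det B = 1 -> \tr A = u -> \tr B = u -> \tr (A * B) = - u ->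
  exists2 P, P \is a GRing.unit &
    A = P * mx2 t (- u * (1 + t^-1)) 0 t^-1 * P^-1 /\
    B = P * mx2 0 (- 1) 1 u * P^-1.
Proof.
move=> t1 u; have t0 : 0 < t by lra.
have [v [tv v0 v1]] : exists v, [/\ t * v = 1, 0 < v & v < 1].
  by exists t^-1; rewrite divff ?gt_eqF // invr_gt0 invf_lt1.
have vE : t^-1 = v by rewrite -[RHS](mulKf (lt0r_neq0 t0)) tv mulr1.
rewrite (mx2_eta A) (mx2_eta B) mx2_mul !mx2_det !mx2_tr /u vE {u}.
move: (A 0 0) (A 0 1) (A 1 0) (A 1 1) => a b c d {A}.
move: (B 0 0) (B 0 1) (B 1 0) (B 1 1) => p q r s {B} dA dB tA tB tAB.
have [x [y [xy e1 e2]]] : exists x y, [/\ (x != 0) || (y != 0),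
    a * x + b * y = t * x & c * x + d * y = t * y].
  by apply: eigenvector_mx2; rewrite ?vE.
pose k := - (t + v) * (1 + v).
have kE : k = (t + v) * t - (t + v) - (t + v) ^+ 2 by rewrite /k; nra.
have [u uE] : exists u, u = t + v by exists (t + v).
rewrite -uE -/k in kE *; rewrite -uE in tA tB tAB.
pose x' := p * x + q * y; pose y' := r * x + s * y.
have aE : d = u - a by rewrite -tA; ring.
have sE : s = u - p by rewrite -tB; ring.
have f1 : p * x' + q * y' = u * x' - x.
  by rewrite -[X in _ - X]mul1r -dB /x' /y' -tB; ring.
have f2 : r * x' + s * y' = u * y' - y.
  by rewrite -[X in _ - X]mul1r -dB /x' /y' -tB; ring.
have g1 : a * x' + b * y' = k * x + v * x'.
  have -> : k * x + v * x' = u * x' - (p * (t * x) + q * (t * y)) + u * (t * x)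
      - u * x - u ^+ 2 * x by rewrite kE /x' uE; ring.
  have := congr1 ( *%R^~ x) tAB; rewrite -e1 -e2 /x' /y' aE sE /=; lra.
have g2 : c * x' + d * y' = k * y + v * y'.
  have -> : k * y + v * y' = u * y' - (r * (t * x) + s * (t * y)) + u * (t * y)
      - u * y - u ^+ 2 * y by rewrite kE /y' uE; ring.
  have := congr1 ( *%R^~ y) tAB; rewrite -e1 -e2 /x' /y' aE sE /=; lra.
have D : x * y' - x' * y != 0.
  rewrite subr_eq0 (mulrC x'); apply/eqP => /(proportional xy)[m [mx my]].
  have k1 : k + v * m = m * t.
    apply: (cancel_vector xy).
      by move: g1 (congr1 ( *%R m) e1); rewrite mx my; lra.
    by move: g2 (congr1 ( *%R m) e2); rewrite mx my; lra.
  have m1 : m ^+ 2 = u * m - 1.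
    apply: (cancel_vector xy).
      by move: f1; rewrite mx my; move: (congr1 ( *%R m) mx); rewrite /x' /=; lra.
    by move: f2; rewrite mx my; move: (congr1 ( *%R m) my); rewrite /y' /=; lra.
  have : (m - t) * (m - v) = 0 by move: m1; rewrite uE; lra.
  move=> /eqP; rewrite mulf_eq0 !subr_eq0 => /orP[] /eqP mE;
    by move: k1; rewrite kE mE uE; nra.
pose P := mx2 x x' y y'; pose Q := (x * y' - x' * y)^-1 *: mx2 y' (- x') (- y) x.
have PQ : P * Q = 1.
  rewrite -scalerAr mx2_mul mx2_1; apply/matrixP => i j; rewrite !mxE.
  by do 2 case: ifP => _; field.
have PU : P \is a GRing.unit.
  by apply/unitrP; exists Q; split => //; apply: left_inverse_mx2.
exists P => //; rewrite -/k; split; apply: (canRL (mulrK PU)); rewrite !mx2_mul;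
  congr mx2; move: e1 e2 f1 f2 g1 g2; rewrite /x' /y' /k uE; lra.
Qed.

Lemma pair_conjugate (t : R) A B A' B' : 1 < t ->
  let u := t + t^-1 in
  \det A = 1 -> \det B = 1 -> \tr A = u -> \tr B = u -> \tr (A * B) = - u ->
  \det A' = 1 -> \det B' = 1 -> \tr A' = u -> \tr B' = u ->
  \tr (A' * B') = - u ->
  exists2 P, P \is a GRing.unit & A = P * A' * P^-1 /\ B = P * B' * P^-1.
Proof.
move=> t1 u dA dB tA tB tAB dA' dB' tA' tB' tAB'.
have [P uP [-> ->]] := pair_normal_form t1 dA dB tA tB tAB.
have [Q uQ [-> ->]] := pair_normal_form t1 dA' dB' tA' tB' tAB'.
exists (P * Q^-1); first by rewrite unitrMl ?unitrV.
by rewrite invrM ?unitrV // invrK !mulrA !mulrVK //; split; rewrite mulrVK.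
Qed.
End NormalForm.

(** * The reflection group of three equidistant geodesics *)

Section Model.
Context {R : realType}.
Variable rho : R.
Hypothesis rho0 : 0 < rho.

Definition sqrt3 : R := Num.sqrt 3.
Lemma sqrt3_sqr : sqrt3 ^+ 2 = 3.
Proof. by rewrite sqr_sqrtr. Qed.
Lemma sqrt3_gt0 : 0 < sqrt3.
Proof. by rewrite sqrtr_gt0. Qed.

(** Of the two lifts of the rotation, this is the one with cube 1. *)
Definition rot120 : 'M[R]_2 := mx2 (- 2^-1) (- (sqrt3 / 2)) (sqrt3 / 2) (- 2^-1).

(** The hyperbolic reflections in the geodesics obtained from [|z| = rho] by the
    rotations of order three about [i].  Matrices of determinant [-1] stand for
    the antiholomorphic isometries [z |-> (a z^* + b) / (c z^* + d)], and the
    exponent [2 * i] stands for [- i]. *)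
Definition mirror0 : 'M[R]_2 := mx2 0 rho rho^-1 0.
Definition mirror (i : nat) : 'M[R]_2 := rot120 ^+ i * mirror0 * rot120 ^+ (2 * i).

Lemma rot120_sqr : rot120 ^+ 2 = mx2 (- 2^-1) (sqrt3 / 2) (- (sqrt3 / 2)) (- 2^-1).
Proof.
have q3 := sqrt3_sqr.
by rewrite expr2 mx2_mul; congr mx2; nra.
Qed.

Lemma rot120_cube : rot120 ^+ 3 = 1.
Proof.
have q3 := sqrt3_sqr.
by rewrite exprS rot120_sqr mx2_mul mx2_1; congr mx2; nra.
Qed.

Lemma rot120_mod3 i : rot120 ^+ (i %% 3) = rot120 ^+ i.
Proof. exact: expr_mod rot120_cube. Qed.

Lemma mirror0K : mirror0 * mirror0 = 1.
Proof. by have r0 := lt0r_neq0 rho0; rewrite mx2_mul mx2_1; congr mx2; field. Qed.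

Lemma mirrorK i : mirror i * mirror i = 1.
Proof.
rewrite /mirror -!mulrA (mulrA (rot120 ^+ (2 * i)) (rot120 ^+ i)) -exprD.
have -> : rot120 ^+ (2 * i + i) = 1 by rewrite -mulSnr exprM rot120_cube expr1n.
rewrite mul1r (mulrA mirror0) mirror0K mul1r -exprD -mulSn exprM rot120_cube expr1n //.
Qed.

Lemma mirror_mod3 i : mirror (i %% 3) = mirror i.
Proof.
rewrite /mirror rot120_mod3; congr (_ * _).
by rewrite -[LHS]rot120_mod3 -[RHS]rot120_mod3 modnMmr.
Qed.

Lemma mirrorM_cancel i j k :
  mirror i * mirror k * (mirror k * mirror j) = mirror i * mirror j.
Proof. by rewrite mulrA -(mulrA (mirror i)) mirrorK mulr1. Qed.

(** A reduced word in the three reflections is a first letter together with a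
    turn by one or two thirds of the circle, to the next letter, for each
    further letter.  Written with [rot120] and [mirror0] only, such a word has
    one factor [mirror0] for each letter. *)
Definition turn (e : bool) : nat := if e then 1 else 2.

Fixpoint word (es : seq bool) : 'M[R]_2 :=
  if es is e :: es' then mirror0 * rot120 ^+ turn e * word es' else mirror0.

Definition total_turn (es : seq bool) : nat := sumn (map turn es).

Definition reflection_word i es :=
  rot120 ^+ i * word es * rot120 ^+ (2 * (i + total_turn es)).

Lemma reflection_word_nil i : reflection_word i [::] = mirror i.
Proof. by rewrite /reflection_word addn0. Qed.

Lemma reflection_word_cons i e es :
  reflection_word i (e :: es) = mirror i * reflection_word (i + turn e) es.
Proof.
have rotK : rot120 ^+ (2 * i) * rot120 ^+ (i + turn e) = rot120 ^+ turn e.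
  by rewrite -exprD addnA -mulSnr exprD exprM rot120_cube expr1n mul1r.
rewrite /reflection_word /mirror -[total_turn _]/(turn e + total_turn es)%N addnA.
by rewrite -!mulrA (mulrA (rot120 ^+ (2 * i))) rotK /= !mulrA.
Qed.

(** Signed normal forms in the free product of [rot120] (order 3) and [mirror0]
    (order 2). *)
Definition free_product_word (x : bool * 'I_3 * 'I_3 * option (seq bool)) :=
  let: (b, i, j, o) := x in
  (-1) ^+ b * (rot120 ^+ i * (if o is Some es then word es else 1) * rot120 ^+ j).

Definition word_set : set 'M[R]_2 := range free_product_word.

Local Open Scope classical_set_scope.

Lemma word_set1 : word_set 1.
Proof. by exists (false, 0, 0, None) => //=; rewrite !expr0 !mul1r. Qed.

Lemma word_setN U : word_set U -> word_set (- U).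
Proof.
move=> [[[[b i] j] o] _ <-]; exists (~~ b, i, j, o) => //=.
by case: b; rewrite /= ?expr0 ?expr1 ?mulN1r ?mul1r ?opprK.
Qed.

Definition ord3 (i : nat) : 'I_3 := Ordinal (ltn_pmod i (isT : 0 < 3)%N).

Lemma word_set_intro b i j o : word_set ((-1) ^+ (b : bool) *
  (rot120 ^+ i * (if o is Some es then word es else 1) * rot120 ^+ j)).
Proof. by exists (b, ord3 i, ord3 j, o) => //=; rewrite !rot120_mod3. Qed.

Lemma mulr_signr b (A B : 'M[R]_2) : A * ((-1) ^+ (b : bool) * B) = (-1) ^+ b * (A * B).
Proof. by case: b; rewrite ?expr1 ?expr0 ?mulN1r ?mul1r // mulrN. Qed.

Lemma word_set_rot U : word_set U -> word_set (rot120 * U).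
Proof.
move=> [[[[b i] j] o] _ <-] /=; have := word_set_intro b i.+1 j o.
by rewrite exprS mulr_signr !mulrA.
Qed.

Lemma word_set_mirror0 U : word_set U -> word_set (mirror0 * U).
Proof.
move=> [[[[b i] j] o] _ <-]; rewrite /= mulr_signr.
have intro e : rot120 ^+ turn e = rot120 ^+ i -> word_set ((-1) ^+ b * (mirror0 *
    (rot120 ^+ i * (if o is Some es then word es else 1) * rot120 ^+ j))).
  move=> <-; case: o => [es|].
    have := word_set_intro b 0 j (Some (e :: es)).
    by rewrite expr0 mul1r /= !mulrA.
  have := word_set_intro b 0 (turn e + j) (Some [::]).
  by rewrite expr0 mul1r /= exprD !mulrA mulr1.
case: i intro => [[|[|[|//]]] ?] /= intro.
- rewrite expr0 mul1r; case: o {intro} => [[|e es]|] /=.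
  + have := word_set_intro b 0 j None.
    by rewrite expr0 mul1r (mulrA mirror0) mirror0K.
  + have := word_set_intro b (turn e) j (Some es).
    by rewrite -!mulrA (mulrA mirror0 mirror0) mirror0K mul1r.
  + have := word_set_intro b 0 j (Some [::]).
    by rewrite expr0 !mul1r.
- exact: (intro true).
- exact: (intro false).
Qed.

Lemma mirrorS i : mirror i.+1 = rot120 * mirror i * rot120 ^+ 2.
Proof. by rewrite /mirror exprS mulnS addnC exprD !mulrA. Qed.

Lemma rot_tail_mul (A B : 'M[R]_2) :
  (rot120 * A * rot120 ^+ 2) * (rot120 * B * rot120 ^+ 2) =
  rot120 * (A * B) * rot120 ^+ 2.
Proof.
have rr : rot120 ^+ 2 * rot120 = 1 by rewrite -exprSr rot120_cube.
move: (rot120 ^+ 2) rr => r2 rr.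
by rewrite -!mulrA (mulrA r2 rot120) rr mul1r.
Qed.

Lemma det_mirror i : \det (mirror i) = -1.
Proof.
have d : \det (rot120 ^+ i) * \det (rot120 ^+ (2 * i)) = 1.
  by rewrite -det_mulr -exprD -mulSn exprM rot120_cube expr1n det1.
rewrite /mirror !det_mulr mulrAC d mul1r mx2_det mul0r divff ?sub0r //.
exact: lt0r_neq0.
Qed.

(** The product of two reflections translates by twice the distance of their
    geodesics, which is thus determined by [rho]. *)
Lemma tr_mirror_consecutive i :
  \tr (mirror i * mirror i.+1) = 2^-1 - 3 / 4 * (rho ^+ 2 + rho^-1 ^+ 2).
Proof.
elim: i => [|i IHi].
  have r0 := lt0r_neq0 rho0; have q3 := sqrt3_sqr.
  rewrite mirrorS /mirror !expr0 mul1r mulr1 rot120_sqr !mx2_mul mx2_tr.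
  rewrite [LHS](_ : _ = 2^-1 * (rho * rho^-1) -
      sqrt3 ^+ 2 / 4 * (rho ^+ 2 + rho^-1 ^+ 2)); last by field.
  by rewrite q3 divff ?mulr1.
rewrite (mirrorS i) (mirrorS i.+1) rot_tail_mul -IHi.
have -> : rot120 ^+ 2 = rot120^-1.
  by rewrite (@invr_mx2 _ _ (rot120 ^+ 2)) // -exprS rot120_cube.
apply: mxtrace_conj; apply/unitrP; exists (rot120 ^+ 2).
by rewrite -exprS -exprSr rot120_cube.
Qed.

End Model.

(** * Comparison of the surface group with the reflection group *)

Section PantsGroup.
Context {R : realType}.
Local Open Scope classical_set_scope.

(** By rigidity of the traces, [c 0] and [c 1] are simultaneously conjugate, up to
    sign, to [mirror 0 * mirror 1] and [mirror 1 * mirror 2].  Hence [G] is, up to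
    conjugation and signs, the group of the words of even length in the
    reflections.  For an upper bound on the exponent it is enough that [G]
    consists of words of any length, for a lower bound that it contains those
    of even length with a given first letter. *)
Lemma pants_group_words (l rho : R) (G : set 'M[R]_2) :
  0 < l -> 0 < rho ->
  3 / 4 * (rho ^+ 2 + rho^-1 ^+ 2) = expR (l / 2) + expR (- (l / 2)) + 2^-1 ->
  moduli_0_3 l l l G ->
  exists P, [/\ P \is a GRing.unit,
    forall g, G g -> exists2 U, word_set rho U & g = P * U * P^-1
  & forall es, odd (size es) -> G (P * reflection_word rho 0 es * P^-1) \/
                                G (- (P * reflection_word rho 0 es * P^-1))].
Proof.
move=> l0 r0 rhoE [[[G1 Gdet GM GV] _ _] [c [h [disj _ [Gc Gmin] cprod]]]].
have [A [B [dA dB [tA tB tAB] cA cB]]] := pants_boundary_traces l0 G1 disj cprod.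
set u := expR (l / 2) + expR (- (l / 2)) in rhoE tA tB tAB.
have dcons i : \det (- (mirror rho i * mirror rho i.+1)) = 1.
  rewrite -mulN1r det_mulr det_mulr !det_mirror // -scaleN1r detZ det1.
  by rewrite !mulrNN !mulr1 expr2 mulrNN mulr1.
have tcons i : \tr (- (mirror rho i * mirror rho i.+1)) = u.
  by rewrite raddfN /= tr_mirror_consecutive // rhoE; ring.
have tAB' : \tr (- (mirror rho 0 * mirror rho 1) * - (mirror rho 1 * mirror rho 2)) = - u.
  rewrite mulrNN mirrorM_cancel // -(tcons 2).
  by rewrite raddfN /= opprK mxtrace_mulC -(mirror_mod3 rho 3).
have [P uP [AE BE]] : exists2 P, P \is a GRing.unit &
    A = P * - (mirror rho 0 * mirror rho 1) * P^-1 /\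
    B = P * - (mirror rho 1 * mirror rho 2) * P^-1.
  have t1 : 1 < expR (l / 2) by rewrite expR_gt1 divr_gt0.
  by apply: (pair_conjugate t1); rewrite ?dcons ?tcons -?expRN.
have cE i : exists2 W, W = mirror rho i * mirror rho i.+1 \/
                       W = - (mirror rho i * mirror rho i.+1)
    & (i < 2)%N -> c (ord3 i) = P * W * P^-1.
  case: i => [|[|i]]; last by exists (mirror rho i.+2 * mirror rho i.+3) => //; left.
    have -> : ord3 0 = 0 by apply/val_inj.
    case: cA => ->; rewrite AE; [exists (- (mirror rho 0 * mirror rho 1)); auto|].
    by exists (mirror rho 0 * mirror rho 1); auto => _; rewrite mulrN mulNr opprK.
  have -> : ord3 1 = 1 by apply/val_inj.
  case: cB => ->; rewrite BE; [exists (- (mirror rho 1 * mirror rho 2)); auto|].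
  by exists (mirror rho 1 * mirror rho 2); auto => _; rewrite mulrN mulNr opprK.
exists P; split => //.
- (* the elements whose conjugates preserve the set of words form a group *)
  pose H : set 'M[R]_2 := [set g | \det g = 1 /\ forall V, word_set rho V ->
    word_set rho (P^-1 * g * P * V) /\ word_set rho (P^-1 * g^-1 * P * V)].
  have HG : SL2_subgroup H.
    split.
    + by split; [exact: det1 | move=> V XV; rewrite invr1 !mulr1 mulVr // mul1r].
    + by move=> g [].
    + move=> g k [dg Hg] [dk Hk]; split; first by rewrite det_mulr dg dk mulr1.
      move=> V XV; rewrite invrM ?det1_unit //; split.
        by have := (Hg _ (Hk _ XV).1).1; rewrite !mulrA mulrK.
      by have := (Hk _ (Hg _ XV).2).2; rewrite !mulrA mulrK.
    + move=> g [dg Hg]; split; first by rewrite -[g^-1]/(invmx _) det_inv dg invr1.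
      by move=> V XV; rewrite invrK; have [] := Hg _ XV.
  have Xrefl i V : word_set rho V -> word_set rho (mirror rho i * V).
    have Xrot k V' : word_set rho V' -> word_set rho (rot120 ^+ k * V').
      elim: k V' => [|k IHk] V' XV'; first by rewrite expr0 mul1r.
      by rewrite exprS -mulrA; apply: word_set_rot; apply: IHk.
    move=> XV; rewrite /mirror -!mulrA; apply: (Xrot); apply: word_set_mirror0 => //.
    exact: Xrot.
  have Xrr i j V : word_set rho V -> word_set rho (mirror rho i * mirror rho j * V).
    by move=> XV; rewrite -(mulrA (mirror rho i)); apply: (Xrefl); apply: Xrefl.
  have Hc i : (i < 2)%N -> H (c (ord3 i)).
    move=> i2; split; first exact: Gdet.
    move=> V XV; have [W WE /(_ i2) ->] := cE i.
    have Winv : W^-1 = mirror rho i.+1 * mirror rho i \/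
                W^-1 = - (mirror rho i.+1 * mirror rho i).
      by case: WE => ->; [left|right]; apply: invr_mx2;
        rewrite ?mulrNN mirrorM_cancel // mirrorK.
    have WU : W \is a GRing.unit.
      apply: det1_unit.
      by case: WE => ->; rewrite ?dcons // det_mulr !det_mirror // mulrNN mulr1.
    split.
      rewrite !mulrA mulVr // mul1r mulrVK //.
      by case: WE => ->; rewrite ?mulNr; [|apply: word_setN]; apply: (Xrr).
    rewrite !invrM ?unitrMl ?unitrV // invrK !mulrA mulVr // mul1r mulrVK //.
    by case: Winv => ->; rewrite ?mulNr; [|apply: word_setN]; apply: (Xrr).
  have H2 : H (c (lift ord0 (lift ord0 ord0))).
    have [_ _ HM HV] := HG; move: cprod; rewrite !big_ord_recl big_ord0 mulr1 mulrA.
    have -> : ord0 = ord3 0 by apply/val_inj.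
    have -> : lift (ord3 0) ord0 = ord3 1 by apply/val_inj.
    move=> cprod.
    rewrite -(invr_mx2 cprod); apply: HV; apply: HM; exact: Hc.
  have HcT (j : 'I_3) : H (c j).
    case: j => [[|[|[|//]]] ?].
    + rewrite (_ : Ordinal _ = ord3 0); [exact: Hc | exact/val_inj].
    + rewrite (_ : Ordinal _ = ord3 1); [exact: Hc | exact/val_inj].
    + rewrite (_ : Ordinal _ = lift ord0 (lift ord0 ord0)); [exact: H2 | exact/val_inj].
  move=> g /(Gmin _ HG HcT)[_ /(_ _ (word_set1 rho))[+ _]].
  rewrite mulr1 => Xg; exists (P^-1 * g * P) => //.
  by rewrite !mulrA mulrK // mulrV // mul1r.
- (* the products of two reflections generate the words of even length *)
  pose Y U := G (P * U * P^-1) \/ G (- (P * U * P^-1)).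
  have YM U V : Y U -> Y V -> Y (U * V).
    have PUV : P * (U * V) * P^-1 = P * U * P^-1 * (P * V * P^-1).
      by rewrite !mulrA mulrVK.
    rewrite /Y PUV => -[YU|YU] [YV|YV]; move: (GM _ _ YU YV);
      rewrite ?(mulNr, mulrN, opprK); by [left|right].
  have Y1 : Y 1 by left; rewrite mulr1 mulrV.
  have Yc i : (i < 2)%N -> Y (mirror rho i * mirror rho i.+1).
    move=> i2; have [Gc' _] := (Gc (ord3 i), i2); move: Gc'.
    have [W [->|->] /(_ i2) ->] := cE i; first by left.
    by rewrite mulrN mulNr; right.
  have YV U V : U * V = 1 -> Y U -> Y V.
    move=> UV; have PV : (P * U * P^-1) * (P * V * P^-1) = 1.
      by rewrite !mulrA mulrVK // -(mulrA P) UV mulr1 mulrV.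
    have PV' : - (P * U * P^-1) * - (P * V * P^-1) = 1 by rewrite mulrNN.
    by case=> /GV; [rewrite (invr_mx2 PV); left | rewrite (invr_mx2 PV'); right].
  have Y0 i : Y (mirror rho 0 * mirror rho i).
    rewrite -(mirror_mod3 rho i); have := ltn_pmod i (isT : 0 < 3)%N.
    case: (i %% 3)%N => [|[|[|//]]] _; first by rewrite mirrorK.
      exact: Yc.
    have := YM _ _ (Yc 0%N isT) (Yc 1%N isT).
    by rewrite mirrorM_cancel.
  have Yij i j : Y (mirror rho i * mirror rho j).
    have Yi0 : Y (mirror rho i * mirror rho 0).
      by apply: YV (Y0 i); rewrite mirrorM_cancel // mirrorK.
    by have := YM _ _ Yi0 (Y0 j); rewrite mirrorM_cancel.
  suff YW n i es : (size es <= n)%N -> odd (size es) -> Y (reflection_word rho i es).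
    by move=> es; apply: YW (leqnn _).
  elim: n i es => [|n IHn] i [|e [|e' es]] //=.
    by rewrite reflection_word_cons // reflection_word_nil.
  rewrite ltnS negbK => le_n odd_es; rewrite !reflection_word_cons // mulrA.
  by apply: YM => //; apply: IHn => //; apply: ltnW.
Qed.
End PantsGroup.

(** * Growth of words *)

Section Dynamics.
Context {R : realType}.
Variable rho : R.
Hypothesis rho0 : 0 < rho.
Hypothesis rho3 : 3 < rho ^+ 2.
Implicit Types (v w : R * R) (A B : 'M[R]_2) (es : seq bool).

Local Notation s := (@sqrt3 R).

Definition act A v : R * R :=
  (A 0 0 * v.1 + A 0 1 * v.2, A 1 0 * v.1 + A 1 1 * v.2).

Lemma actM A B v : act (A * B) v = act A (act B v).
Proof.
rewrite {1}(mx2_eta A) {1}(mx2_eta B) mx2_mul /act !mxE /=.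
by congr pair; ring.
Qed.

Lemma act1 v : act 1 v = v.
Proof. by case: v => x y; rewrite /act !mxE /= !mul1r !mul0r addr0 add0r. Qed.

(** Bounds for the factor by which one letter expands the first coordinate; the
    square of the first one is [2 * cosh (l / 2) - 1], that of the second one
    [2 * cosh (l / 2) + 2], for boundary geodesics of length [l]. *)
Definition min_stretch : R := s / 2 * (rho - rho^-1).
Definition max_stretch : R := s / 2 * (rho + rho^-1).

Definition step (e : bool) v : R * R := act (mirror0 rho * rot120 ^+ turn e) v.

Definition turn_sign (e : bool) : R := if e then 1 else -1.

Lemma stepE e v : let sg := turn_sign e in
  step e v = (rho * (sg * s * v.1 - v.2) / 2, - (v.1 + sg * s * v.2) / (2 * rho)).
Proof.
have r0 := lt0r_neq0 rho0.
rewrite /step actM /turn_sign; case: e; rewrite /turn ?expr1 ?rot120_sqr /act !mxE /=;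
  by congr pair; field.
Qed.

(** A narrow cone around the horizontal axis, mapped into itself by both
    steps. *)
Definition cone v : Prop := v.1 != 0 /\ rho ^+ 2 * `|v.2| <= s * `|v.1|.

Lemma min_stretch_gt0 : 0 < min_stretch.
Proof.
rewrite mulr_gt0 ?divr_gt0 ?sqrt3_gt0 // subr_gt0 -(ltr_pM2l rho0).
by rewrite divff ?lt0r_neq0 // -expr2; apply: lt_trans rho3; rewrite ltr1n.
Qed.

Lemma max_stretch_gt0 : 0 < max_stretch.
Proof. by rewrite mulr_gt0 ?divr_gt0 ?sqrt3_gt0 // addr_gt0 // invr_gt0. Qed.

(** The product of the coordinates of the image is negative for one of the steps
    and positive for the other, which tells them apart. *)
Lemma step_cone e v : cone v ->
  [/\ cone (step e v), min_stretch * `|v.1| <= `|(step e v).1|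
    & turn_sign e * ((step e v).1 * (step e v).2) < 0].
Proof.
case: v => x y [x0 xy]; rewrite stepE; rewrite /= in x0 xy *.
have [i [ri i0]] : exists i, rho * i = 1 /\ 0 < i.
  by exists rho^-1; rewrite divff ?lt0r_neq0 // invr_gt0.
have iE : rho^-1 = i by rewrite -[LHS]mulr1 -ri mulKf // lt0r_neq0.
have s3 := @sqrt3_sqr R; have s0 := @sqrt3_gt0 R.
have nx : 0 < `|x| by rewrite normr_gt0.
have yx : `|y| <= s * i ^+ 2 * `|x|.
  have -> : `|y| = i ^+ 2 * (rho ^+ 2 * `|y|).
    by rewrite mulrA -exprMn [i * _]mulrC ri expr1n mul1r.
  by rewrite [s * _]mulrC -[leRHS]mulrA ler_wpM2l // sqr_ge0.
have syx : s * `|y| <= 3 * i ^+ 2 * `|x|.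
  have := ler_wpM2l (ltW s0) yx; rewrite !mulrA -expr2 s3; lra.
have i3 : 3 * i ^+ 2 < 1.
  have : i ^+ 2 * 3 < i ^+ 2 * rho ^+ 2 by rewrite ltr_pM2l // exprn_gt0.
  by rewrite -exprMn [i * _]mulrC ri expr1n; lra.
set sg := turn_sign e.
have sg2 : sg ^+ 2 = 1 by rewrite /sg /turn_sign; case: (e); rewrite ?sqrrN expr1n.
have nsg : `|sg| = 1 by rewrite /sg /turn_sign; case: (e); rewrite ?normrN normr1.
have n1 : s * `|x| - `|y| <= `|sg * s * x - y|.
  apply: le_trans (lerB_dist _ _).
  by rewrite !normrM nsg mul1r (gtr0_norm s0).
have n2 : `|x + sg * s * y| <= `|x| + s * `|y|.
  by apply: le_trans (ler_normD _ _) _; rewrite !normrM nsg mul1r (gtr0_norm s0).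
have b1 : min_stretch * `|x| <= `|rho * (sg * s * x - y) / 2|.
  rewrite !normrM (gtr0_norm rho0) (@gtr0_norm _ 2^-1) ?invr_gt0 //.
  have := ler_wpM2l (ltW rho0) n1; rewrite /min_stretch iE => n1'.
  have : rho * `|y| <= s * i * `|x|.
    have -> : s * i * `|x| = rho * (s * i ^+ 2 * `|x|).
      have -> : rho * (s * i ^+ 2 * `|x|) = (rho * i) * (s * i * `|x|) by ring.
      by rewrite ri mul1r.
    by rewrite ler_pM2l.
  lra.
have lx : 0 < min_stretch * `|x| by rewrite mulr_gt0 // min_stretch_gt0.
have b2 : rho ^+ 2 * `|- (x + sg * s * y) / (2 * rho)| <= s * (min_stretch * `|x|).
  rewrite invfM iE !normrM normrN (gtr0_norm i0) (@gtr0_norm _ 2^-1) ?invr_gt0 //.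
  have -> : rho ^+ 2 * (`|x + sg * s * y| * (2^-1 * i)) =
     (rho * i) * rho * `|x + sg * s * y| / 2 by ring.
  have -> : s * (min_stretch * `|x|) = s ^+ 2 / 2 * (rho * `|x| - i * `|x|).
    by rewrite /min_stretch iE; ring.
  rewrite s3 ri mul1r.
  have := ler_wpM2l (ltW rho0) n2.
  have : rho * (s * `|y|) <= 3 * i * `|x|.
    have -> : 3 * i * `|x| = rho * (3 * i ^+ 2 * `|x|).
      have -> : rho * (3 * i ^+ 2 * `|x|) = (rho * i) * (3 * i * `|x|) by ring.
      by rewrite ri mul1r.
    by rewrite ler_pM2l.
  have : 3 * i * `|x| <= rho * `|x|.
    rewrite ler_pM2r // -(ler_pM2l i0) [i * rho]mulrC ri; lra.
  lra.
split => //.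
- split; first by rewrite -normr_gt0; apply: lt_le_trans b1.
  by apply: (le_trans b2); rewrite ler_pM2l.
- have -> : sg * (rho * (sg * s * x - y) / 2 * (- (x + sg * s * y) / (2 * rho))) =
     - ((s * x ^+ 2 - s * y ^+ 2 + sg * 2 * (x * y)) / 4).
    have -> : s * x ^+ 2 - s * y ^+ 2 + sg * 2 * (x * y) =
      sg ^+ 2 * s * x ^+ 2 - sg ^+ 2 * s * y ^+ 2 +
        sg * (sg ^+ 2 * s ^+ 2 - 1) * (x * y) by rewrite sg2 s3; ring.
    by field; rewrite lt0r_neq0.
  rewrite oppr_lt0 divr_gt0 //.
  have : - (sg * (x * y)) <= `|x| * `|y|.
    by apply: le_trans (ler_norm _) _; rewrite normrN !normrM nsg mul1r.
  rewrite -(real_normK (num_real x)) -(real_normK (num_real y)) => n3.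
  have yx' : s * `|y| < `|x|.
    by apply: le_lt_trans syx _; rewrite gtr_pMl.
  have : 0 < (s * `|x| + `|y|) * (`|x| - s * `|y|).
    by rewrite mulr_gt0 ?subr_gt0 // ltr_wpDr // mulr_gt0.
  have -> : (s * `|x| + `|y|) * (`|x| - s * `|y|) =
    s * `|x| ^+ 2 - s * `|y| ^+ 2 - (s ^+ 2 - 1) * (`|x| * `|y|) by ring.
  rewrite s3; lra.
Qed.

(** The hypotheses describe the ball of radius [M] of a weighted sup norm, for
    which both steps have operator norm at most [max_stretch]. *)
Lemma step_le e v (M : R) : `|v.1| <= M -> rho ^+ 2 * `|v.2| <= s * M ->
  `|(step e v).1| <= max_stretch * M /\
  rho ^+ 2 * `|(step e v).2| <= s * (max_stretch * M).
Proof.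
case: v => x y; rewrite stepE /= => xM yM.
have [i [ri i0]] : exists i, rho * i = 1 /\ 0 < i.
  by exists rho^-1; rewrite divff ?lt0r_neq0 // invr_gt0.
have iE : rho^-1 = i by rewrite -[LHS]mulr1 -ri mulKf // lt0r_neq0.
have s3 := @sqrt3_sqr R; have s0 := @sqrt3_gt0 R.
have ry : rho * `|y| <= s * (i * M).
  have -> : rho * `|y| = i * (rho ^+ 2 * `|y|).
    have -> : i * (rho ^+ 2 * `|y|) = (rho * i) * (rho * `|y|) by ring.
    by rewrite ri mul1r.
  by rewrite [leRHS]mulrCA ler_pM2l.
have nsg : `|turn_sign e| = 1 by rewrite /turn_sign; case: (e); rewrite ?normrN normr1.
have n1 : `|turn_sign e * s * x - y| <= s * `|x| + `|y|.
  by apply: le_trans (ler_normB _ _) _; rewrite !normrM nsg mul1r (gtr0_norm s0).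
have n2 : `|x + turn_sign e * s * y| <= `|x| + s * `|y|.
  by apply: le_trans (ler_normD _ _) _; rewrite !normrM nsg mul1r (gtr0_norm s0).
have M0 : 0 <= M by apply: le_trans xM.
split.
  rewrite !normrM (gtr0_norm rho0) (@gtr0_norm _ 2^-1) ?invr_gt0 //.
  rewrite /max_stretch iE.
  have := ler_wpM2l (ltW rho0) n1.
  have := ler_wpM2l (ltW (mulr_gt0 rho0 s0)) xM; lra.
rewrite invfM iE !normrM normrN (gtr0_norm i0) (@gtr0_norm _ 2^-1) ?invr_gt0 //.
have -> : rho ^+ 2 * (`|x + turn_sign e * s * y| * (2^-1 * i)) =
   (rho * i) * rho * `|x + turn_sign e * s * y| / 2 by ring.
have -> : s * (max_stretch * M) = s ^+ 2 / 2 * (rho * M + i * M).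
  by rewrite /max_stretch iE; ring.
rewrite s3 ri mul1r.
have := ler_wpM2l (ltW rho0) n2.
have := ler_wpM2l (ltW rho0) xM.
have : s * (rho * `|y|) <= 3 * (i * M).
  by rewrite -s3 expr2 -mulrA ler_pM2l.
have : 0 <= rho * M by rewrite mulr_ge0 // ltW.
have : 0 <= i * M by rewrite mulr_ge0 // ltW.
lra.
Qed.

(** The vectors that [mirror0] sends into [cone]. *)
Definition vertical v : Prop := v.2 != 0 /\ `|v.1| <= s * `|v.2|.

Lemma act_word_nil v : act (word rho [::]) v = (rho * v.2, rho^-1 * v.1).
Proof. by rewrite /act !mxE /= !mul0r add0r addr0. Qed.

Lemma act_word_cons e es v :
  act (word rho (e :: es)) v = step e (act (word rho es) v).
Proof. by rewrite /step -actM. Qed.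

Lemma word_cone es v : vertical v ->
  cone (act (word rho es) v) /\
  min_stretch ^+ size es * (rho * `|v.2|) <= `|(act (word rho es) v).1|.
Proof.
move=> [v2 v1]; have r0 := lt0r_neq0 rho0; elim: es => [|e es [IHc IHs]].
  rewrite act_word_nil expr0 mul1r /cone /= mulf_neq0 //.
  rewrite !normrM normfV (gtr0_norm rho0) lexx; split => //; split => //.
  rewrite expr2 -mulrA mulVKf //.
  by rewrite [leRHS]mulrCA ler_pM2l.
rewrite act_word_cons; have [c l _] := step_cone e IHc; split => //.
by rewrite exprS -mulrA (le_trans _ l) // ler_pM2l // min_stretch_gt0.
Qed.

Lemma word_le es v (M : R) : `|v.2| <= M -> `|v.1| <= s * M ->
  let w := act (word rho es) v in
  `|w.1| <= max_stretch ^+ size es * (rho * M) /\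
  rho ^+ 2 * `|w.2| <= s * (max_stretch ^+ size es * (rho * M)).
Proof.
move=> v2 v1; elim: es => [|e es [IH1 IH2]].
  rewrite act_word_nil expr0 mul1r /= !normrM normfV (gtr0_norm rho0).
  by rewrite expr2 -mulrA mulVKf ?lt0r_neq0 // mulrCA !ler_pM2l.
by rewrite act_word_cons [size _]/= (exprS max_stretch) -mulrA; apply: step_le.
Qed.

Lemma actZ A (m : R) v : act A (m * v.1, m * v.2) = (m * (act A v).1, m * (act A v).2).
Proof. by rewrite /act /=; congr pair; ring. Qed.

Lemma act_inj A v w : A \is a GRing.unit -> act A v = act A w -> v = w.
Proof. by move=> uA /(congr1 (act A^-1)); rewrite -!actM mulVr // !act1. Qed.

(** The letters of a word are read off, from the left, from the quadrants
    containing the image of a vector, as in the ping-pong lemma.  The initial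
    vectors may differ because a reflection word ends with a rotation that
    depends on the word. *)
Lemma word_inj es es' v v' (m : R) : size es = size es' ->
  vertical v -> vertical v' -> m != 0 ->
  act (word rho es) v =
    (m * (act (word rho es') v').1, m * (act (word rho es') v').2) ->
  es = es'.
Proof.
move=> + vv vv' m0; elim: es es' => [|e es IH] [|e' es'] // /succn_inj sz E.
rewrite !act_word_cons in E.
have [c _] := word_cone es vv; have [c' _] := word_cone es' vv'.
have [_ _ n] := step_cone e c; have [_ _ n'] := step_cone e' c'.
have ee : e = e'.
  move: n n'; rewrite E /= => n n'; apply/eqP; apply: contraT => /negP ne.
  have m2 : 0 < m ^+ 2 by rewrite exprn_even_gt0.
  rewrite -(ltr_pM2l m2) mulr0 in n'.
  have tn : turn_sign e' = - turn_sign e.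
    by rewrite /turn_sign; case: (e) (e') ne => [] [] //; rewrite opprK.
  by move: n n'; rewrite tn; lra.
rewrite ee in E *; congr cons; apply: IH => //.
move: E; rewrite /step -actZ; apply: act_inj.
have uR : mirror0 rho \is a GRing.unit.
  by apply/unitrP; exists (mirror0 rho); rewrite mirror0K.
rewrite unitrMl // unitrX //; apply/unitrP; exists (rot120 ^+ 2).
by rewrite -exprS -exprSr rot120_cube.
Qed.

(** The lines spanned by these three vectors are 60 degrees apart, and the
    vertical direction is one of them. *)
Lemma vertical_rot j : vertical (act (rot120 ^+ j) (0, 1)).
Proof.
rewrite -rot120_mod3; have := ltn_pmod j (isT : (0 < 3)%N).
have s0 := @sqrt3_gt0 R; have s3 := @sqrt3_sqr R.
case: (j %% 3)%N => [|[|[|//]]] _; rewrite ?expr0 ?expr1 ?rot120_sqr.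
- by rewrite act1 /vertical /= oner_neq0 normr0 mulr_ge0 // ltW.
- rewrite /act /vertical !mxE /= !mulr0 !mulr1 !add0r !normrN normrM.
  by rewrite (gtr0_norm s0) lexx oppr_eq0 invr_eq0 pnatr_eq0.
- rewrite /act /vertical !mxE /= !mulr0 !mulr1 !add0r !normrN normrM.
  by rewrite (gtr0_norm s0) lexx oppr_eq0 invr_eq0 pnatr_eq0.
Qed.

Lemma frob2_word_ge es : (min_stretch ^+ 2) ^+ size es <= frob2 (word rho es).
Proof.
have v01 : vertical (0, 1).
  by have := vertical_rot 0; rewrite expr0 act1.
have [_ le] := word_cone es v01.
have l0 := min_stretch_gt0.
have r1 : 1 <= rho by rewrite -(@expr_ge1 _ 2) ?(ltW rho0) //; move: rho3; lra.
have : min_stretch ^+ size es <= `|(word rho es) 0 1|.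
  move: le; rewrite /act /= !mulr0 add0r normr1 !mulr1; apply: le_trans.
  by rewrite ler_peMr // exprn_ge0 // ltW.
rewrite -(@ler_pXn2r _ 2) ?nnegrE ?exprn_ge0 ?(ltW l0) // real_normK ?num_real //.
rewrite -exprM mulnC exprM => /le_trans; apply.
rewrite /frob2; have := sqr_ge0 (word rho es 0 0); have := sqr_ge0 (word rho es 1 0).
by have := sqr_ge0 (word rho es 1 1); lra.
Qed.

Lemma frob2_word_le es : frob2 (word rho es) <= 4 * rho ^+ 2 * (max_stretch ^+ 2) ^+ size es.
Proof.
have s0 := @sqrt3_gt0 R; have s3 := @sqrt3_sqr R.
have s1 : 1 <= s by rewrite -(@expr_ge1 _ 2) ?(ltW s0) // s3; lra.
set N := max_stretch ^+ size es * rho.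
have N0 : 0 <= N by rewrite mulr_ge0 ?exprn_ge0 ?(ltW rho0) ?(ltW max_stretch_gt0).
have bound v : `|v.2| <= 1 -> `|v.1| <= 1 ->
    `|(act (word rho es) v).1| <= N /\ `|(act (word rho es) v).2| <= N.
  move=> v2 v1; have := @word_le es v 1 v2; rewrite !mulr1 -/N.
  move=> /(_ (le_trans v1 s1))[l1 l2].
  split => //; have s2 : s <= rho ^+ 2 by apply: (le_trans _ (ltW rho3)); nra.
  rewrite -(ler_pM2l s0); apply: le_trans l2; exact: ler_wpM2r.
have := bound (1, 0); have := bound (0, 1).
rewrite /act /= !mulr0 !mulr1 !add0r !addr0 normr0 normr1 lexx ler01.
move=> /(_ isT isT)[b d] /(_ isT isT)[a c].
have sq x : `|x| <= N -> x ^+ 2 <= N ^+ 2.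
  by move=> xN; rewrite -real_normK ?num_real // ler_pXn2r ?nnegrE.
have -> : 4 * rho ^+ 2 * (max_stretch ^+ 2) ^+ size es = 4 * N ^+ 2.
  by rewrite -exprM mulnC exprM /N exprMn; ring.
by rewrite /frob2; have := sq _ a; have := sq _ b; have := sq _ c; have := sq _ d; lra.
Qed.

End Dynamics.

(** * Sums over words *)

Section Sums.
Context {R : realType}.

(** Entries of [cs] with the same value are counted repeatedly on the right, so
    that no section of [val] has to be chosen. *)
Lemma sum_le_cover (T C : eqType) (f : T -> R) (val : C -> T) (s : seq T) (cs : seq C) :
  (forall x, 0 <= f x) -> uniq s -> {subset s <= [seq val c | c <- cs]} ->
  \sum_(x <- s) f x <= \sum_(c <- cs) f (val c).
Proof.
move=> f0; elim: cs s => [|c cs IH] s us sub.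
  by case: s us sub => [|x s] _ sub; [rewrite !big_nil | have := sub x (mem_head _ _)].
rewrite big_cons; have [cs'|cs'] := boolP (val c \in s).
  rewrite (perm_big _ (perm_to_rem cs')) big_cons lerD2l IH ?rem_uniq // => x.
  rewrite mem_rem_uniq // inE => /andP[/= xc xs].
  by have := sub x xs; rewrite inE (negPf xc).
apply: ler_wpDl => //; apply: IH => // x xs; have := sub x xs; rewrite inE.
by case: eqVneq xs => // -> xs; rewrite xs in cs'.
Qed.

Fixpoint words_below (n : nat) : seq (seq bool) :=
  if n is n'.+1 then
    [::] :: [seq true :: w | w <- words_below n'] ++
            [seq false :: w | w <- words_below n']
  else [::].

Lemma mem_words_below n w : (size w < n)%N -> w \in words_below n.
Proof.
elim: n w => // n IH [|e w] sz //=.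
rewrite in_cons mem_cat; apply/orP; right; apply/orP.
by case: e sz => sz; [left|right]; apply: map_f; apply: IH.
Qed.

(** The bound is the fixed point of [M |-> 1 + 2 * q * M], and the words are the
    empty word and two copies of the shorter words. *)
Lemma sum_words_below_le (q : R) n : 0 <= q -> 2 * q < 1 ->
  \sum_(w <- words_below n) q ^+ size w <= (1 - 2 * q)^-1.
Proof.
move=> q0 q1; have M0 : 0 < 1 - 2 * q by lra.
elim: n => [|n IH]; first by rewrite big_nil invr_ge0 ltW.
have half e : \sum_(w <- [seq e :: w | w <- words_below n]) q ^+ size w =
    q * \sum_(w <- words_below n) q ^+ size w.
  by rewrite big_map mulr_sumr; apply: eq_bigr => w _; rewrite -exprS.
rewrite big_cons big_cat !half expr0.
have -> : (1 - 2 * q)^-1 = 1 + (q * (1 - 2 * q)^-1 + q * (1 - 2 * q)^-1).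
  by field; rewrite gt_eqF.
by rewrite lerD2l lerD // ler_wpM2l.
Qed.

Local Open Scope classical_set_scope.

(** There are [2 ^ n] words of length [n], so the sum over the words is
    geometric of ratio [2 * q]; the finite type [A] and the empty option only
    multiply it by a constant. *)
Lemma esum_words_lt_pinfty (T : choiceType) (A : finType) (G : set T) (f : T -> R)
    (val : A * option (seq bool) -> T) (C q : R) :
  0 <= C -> (forall x, 0 <= f x) -> 0 <= q -> 2 * q < 1 ->
  G `<=` range val ->
  (forall x, f (val x) <= C * q ^+ (if x.2 is Some w then size w else 0)) ->
  (\esum_(x in G) (f x)%:E < +oo)%E.
Proof.
move=> C0 f0 q0 q1 Gval fC.
set M : R := \sum_(a <- enum A) (C + C * (1 - 2 * q)^-1).
apply: (@le_lt_trans _ _ M%:E); last exact: ltry.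
apply: ge_ereal_sup => _ [F [Ffin FG] <-].
rewrite fsbig_finite //= sumEFin lee_fin.
set s := enum_fset (fset_set F).
have us : uniq s by exact: fset_uniq.
have [n sn] : exists n, forall x, x \in s ->
    exists2 c, val c = x & (if c.2 is Some w then size w < n else true)%N.
  have : forall x, x \in s -> range val x.
    by move=> x; rewrite in_fset_set // => /set_mem /FG /Gval.
  elim: s {us} => [|x s IH] H; first by exists 0%N.
  have [n Hn] := IH (fun y ys => H y (mem_behead (s := x :: s) ys)).
  have [[a o] _ xE] := H x (mem_head _ _).
  exists (maxn n (if o is Some w then (size w).+1 else 0)) => y.
  rewrite inE => /predU1P[->|/Hn [[b [w|]] yE /= sz]].
  - by exists (a, o) => //=; case: o {xE} => // w; exact: leq_maxr.
  - by exists (b, Some w) => //=; apply: leq_trans sz (leq_maxl _ _).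
  - by exists (b, None).
have sub : {subset s <= [seq val c | c <-
    [seq (a, o) | a <- enum A, o <- None :: [seq Some w | w <- words_below n]]]}.
  move=> x /sn[[a o] <- on]; apply: map_f; apply/allpairsP; exists (a, o).
  split => //=; first by rewrite mem_enum.
  case: o on => [w /= on|//]; rewrite inE; apply/orP; right.
  by apply: map_f; apply: mem_words_below.
apply: le_trans (sum_le_cover f0 us sub) _.
apply: le_trans (ler_sum _ (fun x _ => fC x)) _.
rewrite big_allpairs /M ler_sum // => a _.
rewrite big_cons big_map /= expr0 mulr1 lerD2l -mulr_sumr ler_wpM2l //.
exact: sum_words_below_le.
Qed.

Lemma esum_ge_card (T : choiceType) (I : finType) (G : set T) (f : T -> R)
    (g : I -> T) (c : R) : injective g -> (forall i, G (g i)) ->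
  (forall i, c <= f (g i)) -> ((#|I|%:R * c)%:E <= \esum_(x in G) (f x)%:E)%E.
Proof.
move=> ginj Gg cf; apply: esum_ge.
pose s := [seq g i | i <- enum I]; have us : uniq s by rewrite map_inj_uniq ?enum_uniq.
exists [set` s].
  by split; [exact: finite_seq | move=> x /= /mapP[i _ ->]].
rewrite -fsbig_seq // sumEFin lee_fin big_map big_enum /= mulr_natl -sumr_const.
by apply: ler_sum => i _; apply: cf.
Qed.

End Sums.

(** * The Poincare series *)

Section CriticalExponent.
Context {R : realType}.
Local Open Scope complex_scope.
Local Open Scope classical_set_scope.
Local Notation ii := (Complex (0 : R) 1).
Implicit Types (G : set 'M[R]_2) (s : R).

(** Divergence for negative exponents follows from divergence at 0, because
    distances are nonnegative. *)
Lemma critical_exponent_itv G (a b : R) : 0 < a ->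
  (forall g, G g -> \det g = 1) ->
  (forall s, 0 <= s < a -> poincare_series G ii ii s = +oo%E) ->
  (forall s, b < s -> (poincare_series G ii ii s < +oo)%E) ->
  a <= critical_exponent G <= b.
Proof.
move=> a0 Gdet div conv; rewrite /critical_exponent.
set S := [set s | _].
have lbS : lbound S a.
  move=> s Ss; rewrite leNgt; apply/negP => sa.
  have [s0|s0] := leP 0 s.
    by move: Ss; rewrite /S /= div ?s0 ?sa // ltxx.
  suff : (poincare_series G ii ii 0 < +oo)%E.
    by rewrite div ?lexx ?a0 // ltxx.
  apply: le_lt_trans Ss; apply: le_esum => g Gg.
  rewrite lee_fin ler_expR oppr0 mul0r mulr_ge0 // ?oppr_ge0; first exact: ltW.
  by apply: hdist_i_ge0; apply: Gdet.
apply/andP; split.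
  by apply: lb_le_inf lbS; exists (b + 1); apply: conv; rewrite ltrDl.
apply/ler_addgt0Pr => e e0; apply: ge_inf; first by exists a.
by apply: conv; rewrite ltrDl.
Qed.

Lemma frob2_conj (P U : 'M[R]_2) : P \is a GRing.unit ->
  frob2 (P * U * P^-1) <= frob2 P * frob2 P^-1 * frob2 U.
Proof.
move=> uP; apply: le_trans (frob2M _ _) _.
by rewrite mulrAC ler_wpM2r ?frob2_ge0 // frob2M.
Qed.

Lemma frob2_conj_ge (P U : 'M[R]_2) : P \is a GRing.unit ->
  frob2 U <= frob2 P * frob2 P^-1 * frob2 (P * U * P^-1).
Proof.
move=> uP; have uP' : P^-1 \is a GRing.unit by rewrite unitrV.
have := frob2_conj (P * U * P^-1) uP'.
by rewrite invrK !mulrA mulVr // mul1r mulrVK // [_ * frob2 P]mulrC.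
Qed.

Lemma frob2_rot120 j : frob2 (rot120 ^+ j : 'M[R]_2) = 2.
Proof.
rewrite -rot120_mod3; have := ltn_pmod j (isT : (0 < 3)%N).
have s3 := @sqrt3_sqr R.
case: (j %% 3)%N => [|[|[|//]]] _; rewrite ?expr0 ?expr1 ?rot120_sqr ?mx2_1
  frob2_mx2; lra.
Qed.

Lemma conj_factor_gt0 (P : 'M[R]_2) : P \is a GRing.unit ->
  0 < frob2 P * frob2 P^-1.
Proof.
move=> uP; apply: lt_le_trans (frob2M P P^-1).
by rewrite mulrV // -(expr0 rot120) frob2_rot120.
Qed.

Section Bounds.
Variables (rho : R) (P : 'M[R]_2) (G : set 'M[R]_2).
Hypothesis rho0 : 0 < rho.
Hypothesis rho3 : 3 < rho ^+ 2.
Hypothesis uP : P \is a GRing.unit.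
Hypothesis Gdet : forall g, G g -> \det g = 1.

Let K := frob2 P * frob2 P^-1.
Let lm := ln (min_stretch rho ^+ 2).
Let lp := ln (max_stretch rho ^+ 2).

Lemma frob2_free_product_word x :
  (min_stretch rho ^+ 2) ^+ (if x.2 is Some w then size w else 0)
    <= 4 * frob2 (free_product_word rho x).
Proof.
case: x => [[[b i] j] o] /=.
pose W : 'M[R]_2 := if o is Some es then word rho es else 1; rewrite -/W.
apply: (@le_trans _ _ (frob2 W)).
  rewrite /W; case: o {W} => [es|]; first exact: frob2_word_ge.
  by rewrite expr0 -(expr0 rot120) frob2_rot120 ler1n.
have WE : W = rot120 ^+ (2 * i) * (rot120 ^+ i * W * rot120 ^+ j) * rot120 ^+ (2 * j).
  rewrite !mulrA -exprD -mulSnr exprM rot120_cube expr1n mul1r.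
  by rewrite -mulrA -exprD -mulSn exprM rot120_cube expr1n mulr1.
rewrite {1}WE.
have -> : frob2 ((-1) ^+ b * (rot120 ^+ i * W * rot120 ^+ j)) =
    frob2 (rot120 ^+ i * W * rot120 ^+ j).
  by case: b; rewrite ?expr0 ?expr1 ?mul1r ?mulN1r ?frob2N.
move: (rot120 ^+ i * W * rot120 ^+ j) => V.
apply: le_trans (frob2M _ _) _; rewrite frob2_rot120.
have := frob2M (rot120 ^+ (2 * i)) V; rewrite frob2_rot120; lra.
Qed.

(** An element given by a word of length [k] moves [i] by at least [k * lm], up to
    a constant, and [2 * expR (- s * lm) < 1]. *)
Lemma poincare_converges s : 1 < min_stretch rho ^+ 2 -> ln 2 / lm < s ->
  (forall g, G g -> exists2 U, word_set rho U & g = P * U * P^-1) ->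
  (poincare_series G ii ii s < +oo)%E.
Proof.
move=> lm1 sgt Gwords.
have K0 : 0 < K := conj_factor_gt0 uP; have lm0 : 0 < lm by exact: ln_gt0.
have s0 : 0 < s by apply: lt_trans sgt; rewrite divr_gt0 // ln_gt0 // ltr1n.
pose f (g : 'M[R]_2) := expR (- s * ln (frob2 g / 2)).
apply: (@le_lt_trans _ _ (\esum_(g in G) (f g)%:E)%E).
  apply: le_esum => g Gg; rewrite lee_fin ler_expR !mulNr lerN2 ler_pM2l //.
  by have /andP[] := hdist_i_bounds (Gdet Gg).
apply: (@esum_words_lt_pinfty _ _ _ _ _ (fun x => P * free_product_word rho x * P^-1)
  (expR (s * ln (8 * K))) (expR (- s * lm))).
- exact: expR_ge0.
- by move=> g; exact: expR_ge0.
- exact: expR_ge0.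
- have e2 : expR (ln 2) = 2 :> R by rewrite lnK ?posrE.
  rewrite -{1}e2 -expRD -[ltRHS]expR0 ltr_expR mulNr subr_lt0.
  by rewrite -ltr_pdivrMr.
- by move=> g /Gwords[U [x _ <-] ->]; exists x.
move=> x; set k : nat := if _ is Some _ then _ else _.
rewrite -expRM_natl -expRD ler_expR.
have L : (min_stretch rho ^+ 2) ^+ k / (8 * K) <=
    frob2 (P * free_product_word rho x * P^-1) / 2.
  have l1 := frob2_free_product_word x.
  have l2 := frob2_conj_ge (free_product_word rho x) uP.
  rewrite ler_pdivrMr; last by rewrite mulr_gt0.
  apply: le_trans l1 _.
  by rewrite -/K in l2; lra.
have p0 : 0 < (min_stretch rho ^+ 2) ^+ k by rewrite exprn_gt0 // (lt_trans _ lm1).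
have : ln ((min_stretch rho ^+ 2) ^+ k / (8 * K)) <=
    ln (frob2 (P * free_product_word rho x * P^-1) / 2).
  rewrite ler_ln ?posrE //; first by rewrite divr_gt0 // mulr_gt0.
  by apply: lt_le_trans L; rewrite divr_gt0 // mulr_gt0.
have K8 : 0 < 8 * K by rewrite mulr_gt0.
rewrite (ln_div p0 K8) lnXn ?(lt_trans _ lm1) // -/lm => /(ler_wpM2l (ltW s0)).
by rewrite -mulr_natl; lra.
Qed.

(** The words of a fixed odd number [k] of turns contribute at least
    [(2 * expR (- s * lp)) ^+ k], up to a constant, with [2 * expR (- s * lp) > 1];
    as [k] grows this is unbounded, so that words of different lengths need not
    be compared. *)
Lemma poincare_diverges s : 1 < max_stretch rho ^+ 2 -> 0 <= s < ln 2 / lp ->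
  (forall es, odd (size es) -> G (P * reflection_word rho 0 es * P^-1) \/
                               G (- (P * reflection_word rho 0 es * P^-1))) ->
  poincare_series G ii ii s = +oo%E.
Proof.
move=> lp1 /andP[s0 slt] words.
have K0 : 0 < K := conj_factor_gt0 uP; have lp0 : 0 < lp by exact: ln_gt0.
pose W (es : seq bool) := P * reflection_word rho 0 es * P^-1.
(* the sign is lost in the conjugation: take the lift that is in the group *)
pose g (es : seq bool) := if `[< G (W es) >] then W es else - W es.
have gW es : g es = W es \/ g es = - W es by rewrite /g; case: ifP; auto.
have Gg es : odd (size es) -> G (g es).
  move=> /words; rewrite /g; case: ifP => [/asboolP//|/asboolP nG].
  by case.
have ginj es es' : size es = size es' -> g es = g es' -> es = es'.
  move=> sz gg.
  have [m m0 E] : exists2 m : R, m != 0 &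
      reflection_word rho 0 es = m *: reflection_word rho 0 es'.
    have inj U V : P * U * P^-1 = P * V * P^-1 -> U = V.
      by move=> /(congr1 (fun X => P^-1 * X * P)); rewrite !mulrA mulVr // !mul1r !mulrVK.
    case: (gW es) (gW es') gg => -> [] ->.
    - by move=> /inj ->; exists 1; rewrite ?scale1r ?oner_neq0.
    - by rewrite /W -mulNr -mulrN => /inj ->; exists (-1);
        rewrite ?scaleN1r ?oppr_eq0 ?oner_neq0.
    - by move=> /esym; rewrite /W -mulNr -mulrN => /inj ->; exists (-1);
        rewrite ?scaleN1r ?opprK ?oppr_eq0 ?oner_neq0.
    - by move=> /oppr_inj /inj ->; exists 1; rewrite ?scale1r ?oner_neq0.
  have := congr1 (fun X => act X (0, 1)) E.
  have -> (X : 'M[R]_2) : act (m *: X) (0, 1) =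
      (m * (act X (0, 1)).1, m * (act X (0, 1)).2).
    by rewrite /act !mxE /=; congr pair; ring.
  rewrite /reflection_word expr0 !mul1r !actM.
  by apply: (word_inj rho0 rho3) => //; apply: vertical_rot.
set c := ln (8 * K * rho ^+ 2).
have dist es : odd (size es) ->
    hdist ii (mobius (g es) ii) <= (size es)%:R * lp + c.
  move=> /Gg /Gdet dg; have /andP[_ +] := hdist_i_bounds dg.
  move=> /le_trans; apply.
  have p0 : 0 < (max_stretch rho ^+ 2) ^+ size es by rewrite exprn_gt0 // (lt_trans _ lp1).
  have K8 : 0 < 8 * K * rho ^+ 2 by rewrite mulr_gt0 ?exprn_gt0 // mulr_gt0.
  have -> : (size es)%:R * lp + c =
      ln ((max_stretch rho ^+ 2) ^+ size es * (8 * K * rho ^+ 2)).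
    by rewrite (lnM p0 K8) lnXn ?(lt_trans _ lp1) // mulr_natl.
  rewrite ler_ln ?posrE; [|by have := frob2_ge2 dg; lra|exact: mulr_gt0].
  have -> : frob2 (g es) = frob2 (W es) by case: (gW es) => ->; rewrite ?frob2N.
  apply: le_trans (frob2_conj _ uP) _; rewrite -/K.
  rewrite /reflection_word expr0 mul1r.
  have := frob2M (word rho es) (rot120 ^+ (2 * (0 + total_turn es))).
  rewrite frob2_rot120 => l1; have l2 := frob2_word_le rho0 rho3 es.
  have := ler_wpM2l (ltW K0) (le_trans l1 (ler_wpM2r (ler0n R 2) l2)); lra.
have sum_ge k : odd k ->
  ((2 ^+ k * expR (- s * (k%:R * lp + c)))%:E <= poincare_series G ii ii s)%E.
  move=> ok; have -> : 2 ^+ k = #|{: k.-tuple bool}|%:R :> R.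
    by rewrite card_tuple card_bool natrX.
  apply: (@esum_ge_card _ _ _ _ _ (fun es : k.-tuple bool => g es)).
  - by move=> es es' /ginj ee; apply/val_inj; apply: ee; rewrite !size_tuple.
  - by move=> es; apply: Gg; rewrite size_tuple.
  - move=> es; rewrite ler_expR !mulNr lerN2 ler_wpM2l //.
    by have := dist es; rewrite size_tuple; apply.
have series0 : (0 <= poincare_series G ii ii s)%E.
  by apply: le_trans (sum_ge 1%N isT); rewrite lee_fin mulr_ge0 ?exprn_ge0 ?expR_ge0.
case/gee0P: series0 => [//|[r r0 seriesE]]; exfalso.
pose x := ln 2 - s * lp; have x0 : 0 < x by rewrite subr_gt0 -ltr_pdivlMr.
pose n := Num.bound (r * expR (s * c) / x).
have nx : r * expR (s * c) < n%:R * x.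
  rewrite -ltr_pdivrMr //; apply: archi_boundP.
  by rewrite divr_ge0 ?mulr_ge0 ?expR_ge0 // ltW.
have := sum_ge n.*2.+1; rewrite /= odd_double seriesE lee_fin => /(_ isT).
have -> : 2 ^+ n.*2.+1 * expR (- s * (n.*2.+1%:R * lp + c)) =
    expR (n.*2.+1%:R * x) / expR (s * c).
  have e2 : expR (ln 2) = 2 :> R by rewrite lnK ?posrE.
  rewrite -{1}e2 -expRM_natl -expRN -!expRD; congr expR.
  by rewrite /x; ring.
apply/negP; rewrite -ltNge ltr_pdivlMr ?expR_gt0 //; apply: lt_le_trans nx _.
apply: le_trans (expR_ge1Dx _); apply: ler_wpDl => //.
by rewrite ler_pM2r // ler_nat -addnn -addnS leq_addr.
Qed.

End Bounds.
End CriticalExponent.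

(** * The asymptotic estimate *)

Lemma reciprocal_sum (R : realType) (c : R) : 2 <= c ->
  exists r : R, [/\ 0 < r, c / 2 <= r ^+ 2 & r ^+ 2 + r^-1 ^+ 2 = c].
Proof.
move=> c2; have d0 : 0 <= c ^+ 2 - 4 by nra.
pose y := (c + Num.sqrt (c ^+ 2 - 4)) / 2.
have s0 := sqrtr_ge0 (c ^+ 2 - 4).
have yc : c / 2 <= y by rewrite /y; lra.
have y0 : 0 < y by lra.
have yE : y * (c - y) = 1 by have := sqr_sqrtr d0; rewrite /y; lra.
exists (Num.sqrt y); rewrite sqrtr_gt0 exprVn sqr_sqrtr; last exact: ltW.
split => //.
have -> : y^-1 = c - y by apply: (mulfI (lt0r_neq0 y0)); rewrite yE mulfV ?lt0r_neq0.
by ring.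
Qed.

(** The parameter [rho] is the one for which the three geodesics are at distance
    [l / 2] of each other. *)
Lemma critical_exponent_pants_bounds (R : realType) (l u : R) (G : set 'M[R]_2) :
  8 <= l -> moduli_0_3 l l l G -> u = expR (l / 2) + expR (- (l / 2)) ->
  ln 2 / ln (u + 2) <= critical_exponent G <= ln 2 / ln (u - 1).
Proof.
move=> l8 GM uE; have l0 : 0 < l by lra.
have u5 : 5 <= u.
  have := expR_ge1Dx (l / 2); have := expR_gt0 (- (l / 2)); rewrite uE; lra.
have [|r [r0 rc rE]] := @reciprocal_sum _ (4 / 3 * (u + 2^-1)); first by lra.
have r3 : 3 < r ^+ 2 by lra.
have rE' : 3 / 4 * (r ^+ 2 + r^-1 ^+ 2) = expR (l / 2) + expR (- (l / 2)) + 2^-1.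
  by rewrite rE -uE; lra.
have [P [uP Gwords wordsG]] := pants_group_words l0 r0 rE' GM.
have Gdet : forall g, G g -> \det g = 1 by case: GM => [[[]]].
have s3 := @sqrt3_sqr R; have rn := lt0r_neq0 r0.
have lmE : min_stretch r ^+ 2 = u - 1.
  have -> : min_stretch r ^+ 2 = sqrt3 ^+ 2 / 4 * (r ^+ 2 + r^-1 ^+ 2 - 2).
    by rewrite /min_stretch; field.
  by rewrite s3 rE; lra.
have lpE : max_stretch r ^+ 2 = u + 2.
  have -> : max_stretch r ^+ 2 = sqrt3 ^+ 2 / 4 * (r ^+ 2 + r^-1 ^+ 2 + 2).
    by rewrite /max_stretch; field.
  by rewrite s3 rE; lra.
apply: critical_exponent_itv => //.
- by rewrite divr_gt0 ?ln_gt0 ?ltr1n //; lra.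
- move=> s sa; apply: (poincare_diverges r0 r3 uP Gdet _ _ wordsG); rewrite lpE //.
  by lra.
- move=> s sb; apply: (poincare_converges r0 r3 uP Gdet _ _ Gwords); rewrite lmE //.
  by lra.
Qed.

Theorem corollary1p6 (R : realType) (eps : R) (heps : 0 < eps) :
  exists K L0 : R,
    [/\ 0 < K, 0 < L0
      & forall (L : R) (G : set 'M[R]_2),
          L0 <= L -> moduli_0_3 L L L G ->
          `|critical_exponent G - ln 4 / L|
            <= K * expR (- ((1 - eps) * L / 4))].
Proof.
(* with [8 <= L] one has [5 <= u] and [3 < rho ^+ 2] in the bounds above *)
exists 1, 8; split => // L G L8 GM.
have L0 : 0 < L by lra.
have /andP[] := critical_exponent_pants_bounds L8 GM (erefl _).
set v := expR (- (L / 2)); have v0 : 0 < v by exact: expR_gt0.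
have tv : expR (L / 2) * v = 1 by rewrite -expRD subrr expR0.
have t5 : 5 <= expR (L / 2) by have := expR_ge1Dx (L / 2); lra.
have v5 : v <= 1 / 5 by nra.
have l2 : 0 < ln 2 :> R by rewrite ln_gt0 // ltr1n.
have l21 : ln 2 <= 1 :> R by have := @le_ln1Dx R 1; rewrite -[1 + 1]/2; apply; lra.
have lnp : ln (expR (L / 2) + v + 2) <= L / 2 + 3 * v.
  have -> : expR (L / 2) + v + 2 = expR (L / 2) * (1 + (v ^+ 2 + 2 * v)).
    by rewrite !mulrDr mulr1 expr2 mulrA tv (mulrCA _ 2) tv; ring.
  rewrite lnM ?posrE ?expR_gt0 ?expRK //; last by nra.
  by rewrite lerD2l; apply: le_trans (le_ln1Dx _) _; nra.
have lnm : L / 2 - 2 * v <= ln (expR (L / 2) + v - 1).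
  rewrite -[leLHS]expRK ler_ln ?posrE ?expR_gt0 //; last by lra.
  rewrite expRD expRN ler_pdivrMr ?expR_gt0 //.
  have := expR_ge1Dx (2 * v) => e1.
  apply: (@le_trans _ _ ((expR (L / 2) + v - 1) * (1 + 2 * v))); first by nra.
  by rewrite ler_pM2l //; lra.
have ln4 : ln 4 / L = ln 2 / (L / 2).
  have -> : 4 = 2 * 2 :> R by ring.
  by rewrite lnM ?posrE //; field; rewrite gt_eqF.
rewrite mul1r ln4 => lo hi.
(* the error is [expR (- (L / 2))], and [(1 - eps) * L / 4 <= L / 2] *)
apply: (@le_trans _ _ v); last first.
  by rewrite ler_expR lerN2; nra.
have H4 : 4 <= L / 2 by lra.
have [B BH] : exists B, B * (L / 2) = ln 2.
  by exists (ln 2 / (L / 2)); rewrite divfK ?gt_eqF //; lra.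
have -> : ln 2 / (L / 2) = B by rewrite -BH mulfK // gt_eqF; lra.
have B0 : 0 < B by nra.
have B1 : B <= 1 / 4 by nra.
rewrite ler_norml; apply/andP; split.
  rewrite lerBrDl; apply: le_trans lo.
  rewrite ler_pdivlMr -?BH; last by rewrite ln_gt0 //; lra.
  have [Bv|vB] := leP B v.
    have : 0 <= ln (expR (L / 2) + v + 2) by rewrite ln_ge0 //; lra.
    nra.
  have := ler_wpM2l (_ : 0 <= B - v) lnp => /(_ ltac:(lra)); nra.
rewrite lerBlDl; apply: (le_trans hi); rewrite ler_pdivrMr -?BH; last by lra.
have := ler_wpM2l (_ : 0 <= B + v) lnm => /(_ ltac:(lra)); nra.
Qed.
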